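(* Let $X=M+A$ be a càdlàg semi-martingale. Then the following are equivalent: (1) $X$ is of class $(\Sigma)$; (2) there exist a continuous finite variation process $V$ and a càdlàg predictable process $C$ (of finite variation) such that $A=C+V$ and, for all $t\ge0$, $$\int_{0}^{t}1_{\{X_{s}\neq0\}}dC_{s}=\int_{0}^{t}1_{\{X_{s-}\neq0\}}dV_{s}=0.$$
   Context: Fix a filtered probability space $(\Omega,\mathcal{F},(\mathcal{F}_{t})_{t\geq0},\mathbf{P})$ satisfying the usual conditions. Writing a semi-martingale as $X=M+A$ means that $M$ is a càdlàg local martingale with $M_0=0$ and $A$ is an adapted càdlàg predictable process of finite variation with $A_{0-}=A_0=0$. $X_{t-}$ is the left limit of $X$ at $t>0$ and $X_{0-}=X_0$. Integrals with respect to $dA$, $dC$, $dV$ are Lebesgue–Stieltjes integrals. Class $(\Sigma)$: $X$ is of class $(\Sigma)$ if it decomposes as $X=M+A$ with $M$ a càdlàg local martingale, $M_0=0$; $A$ an adapted càdlàg predictable process of finite variation with $A_{0-}=A_0=0$; and $\int_{0}^{t}1_{\{X_{s}\neq0\}}dA_{s}=0$ for all $t\geq0$. *)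

(* Defs.v *)
From HB Require Import structures.
From mathcomp Require Import all_boot all_order all_algebra.
From mathcomp Require Import all_classical all_reals all_analysis.

Set Implicit Arguments.
Unset Strict Implicit.
Unset Printing Implicit Defensive.
Import Order.TTheory GRing.Theory Num.Theory.
Import numFieldNormedType.Exports.

Local Open Scope classical_set_scope.
Local Open Scope ring_scope.

(* Conventions.  A real-valued process is a map X : R -> T -> R; only its values
   at times t >= 0 matter.  Path regularity (cadlag, continuous, finite
   variation) holds for every w, whereas identities between processes hold up to
   indistinguishability, i.e., for almost all w, for all t >= 0. *)

Section paths.
Context {R : realType}.
Implicit Types (a h : R -> R) (t : R).

Definition cadlag_path a :=
  (forall t, 0 <= t -> a s @[s --> t^'+] --> a t) /\
  (forall t, 0 < t -> cvg (a s @[s --> t^'-])).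

Definition left_limit_path a t : R :=
  if 0 < t then lim (a s @[s --> t^'-]) else a 0.

Definition finite_variation_path a :=
  forall t, 0 <= t -> bounded_variation 0 t a.

Definition cumulative_of (f : R -> R) (nd : nondecreasing f)
    (rc : right_continuous f) : cumulative R R :=
  HB.pack f (isCumulative.Build R _ R f nd rc).

(* The second branch is a dummy value. *)
Definition stieltjes_measure (f : R -> R) :
    {measure set (measurableTypeR R) -> \bar R} :=
  match pselect (nondecreasing f /\ right_continuous f) with
  | left H => lebesgue_stieltjes_measure (cumulative_of H.1 H.2)
  | right _ => mzero
  end.

(* The Jordan decomposition of a on [0, +oo[ (a = pos_part a - neg_part a),
   extended by constants to ]-oo, 0[. *)
Definition pos_part_path a (s : R) : R := fine (pos_tv 0 a (Num.max 0 s)).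
Definition neg_part_path a (s : R) : R := fine (neg_tv 0 a (Num.max 0 s)).

(* The integral of h with respect to da over ]0, t]: there is no mass at 0
   (this is the convention a_{0-} = a_0). *)
Definition LS_integral a h t : R :=
  \int[stieltjes_measure (pos_part_path a)]_(s in `]0, t]) h s -
  \int[stieltjes_measure (neg_part_path a)]_(s in `]0, t]) h s.

End paths.

Section paths_facts.
Context {R : realType}.
Implicit Types (a : R -> R) (s t : R).

Lemma neg_part_path_nondecreasing a :
  finite_variation_path a -> nondecreasing (neg_part_path a).
Proof.
move=> fa x y xy.
have m0 (z : R) : 0 <= Num.max 0 z by rewrite le_max lexx.
have mxy : Num.max 0 x <= Num.max 0 y by rewrite ge_max m0 le_max xy orbT.
apply: (@fine_neg_tv_nondecreasing R 0 (Num.max 0 y) a) => //.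
- exact: fa.
- by rewrite in_itv/= m0.
- by rewrite in_itv/= m0 lexx.
Qed.

Lemma neg_part_path_right_continuous a :
  finite_variation_path a -> cadlag_path a ->
  right_continuous (neg_part_path a).
Proof.
move=> fa [rca _] x; have [x0|x0] := ltP x 0.
  apply: (@cvg_trans _ ((fun=> neg_part_path a x) @ x^'+)); last exact: cvg_cst.
  apply: near_eq_cvg; near=> y.
  have y0 : y <= 0 by near: y; exact: nbhs_right_le.
by rewrite /neg_part_path !(max_idPl _)// ltW.
have mx : Num.max 0 x = x by apply/max_idPr.
have E : neg_part_path a x = fine (neg_tv 0 a x) by rewrite /neg_part_path mx.
rewrite E.
have x1 : x < x + 1 by rewrite ltrDl.
have H : fine \o neg_tv 0 a @ x^'+ --> fine (neg_tv 0 a x).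
  apply: (neg_tv_right_continuous x0 x1); last exact: rca.
  by apply: fa; exact: le_trans (ltW x1).
apply: cvg_trans H; apply: near_eq_cvg; near=> y.
rewrite /neg_part_path /= (max_idPr _)//.
by apply: (le_trans x0); near: y; exact: nbhs_right_ge.
Unshelve. all: by end_near. Qed.

Lemma finite_variation_pathN a :
  finite_variation_path a -> finite_variation_path (\- a).
Proof. by move=> fa t t0; apply/bounded_variationN/fa. Qed.

Lemma cadlag_pathN a : cadlag_path a -> cadlag_path (\- a).
Proof.
move=> [r l]; split=> t t0; first by apply: cvgN; exact: r.
by apply: is_cvgN; exact: l.
Qed.

Lemma pos_part_path_nondecreasing a :
  finite_variation_path a -> nondecreasing (pos_part_path a).
Proof.
by move=> fa; exact: (neg_part_path_nondecreasing (finite_variation_pathN fa)).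
Qed.

Lemma pos_part_path_right_continuous a :
  finite_variation_path a -> cadlag_path a ->
  right_continuous (pos_part_path a).
Proof.
move=> fa ca; apply: (neg_part_path_right_continuous (a := \- a)).
  exact: finite_variation_pathN.
exact: cadlag_pathN.
Qed.

Lemma stieltjes_measure_itv_oc (f : R -> R) s t : s <= t ->
  nondecreasing f -> right_continuous f ->
  stieltjes_measure f `]s, t]%classic = (f t - f s)%:E.
Proof.
move=> st nd rc.
have lsE (g : cumulative R R) :
    lebesgue_stieltjes_measure g `]s, t]%classic = (g t - g s)%:E.
  rewrite /lebesgue_stieltjes_measure /measure_extension.
  rewrite measurable_mu_extE/=; last exact: is_ocitv.
  by rewrite wlength_itv_bnd.
by rewrite /stieltjes_measure; case: pselect => [H|[]//]; exact: lsE.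
Qed.

(* For a cadlag path of finite variation the dummy branch of
   stieltjes_measure is not used, and da charges ]s, t] by a t - a s. *)
Lemma LS_integral_cst1 a t : finite_variation_path a -> cadlag_path a ->
  0 <= t -> LS_integral a (cst 1) t = a t - a 0.
Proof.
move=> fa ca t0; rewrite /LS_integral !Rintegral_cst//= !mul1r.
have := stieltjes_measure_itv_oc t0 (pos_part_path_nondecreasing fa)
  (pos_part_path_right_continuous fa ca).
have := stieltjes_measure_itv_oc t0 (neg_part_path_nondecreasing fa)
  (neg_part_path_right_continuous fa ca).
move=> /= -> -> /=.
have dec z : 0 <= z -> a z = pos_part_path a z - neg_part_path a z.
  move=> z0; rewrite /pos_part_path /neg_part_path (max_idPr z0).
  by apply: (bounded_variation_pos_neg_tvE (fa _ z0)); rewrite in_itv/= z0 lexx.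
rewrite (dec _ t0) (dec _ (lexx 0)) !opprB addrACA [RHS]addrACA.
by rewrite [in RHS](addrC (- _)) addrC.
Qed.

End paths_facts.

Section processes.
Context {R : realType} {d : measure_display} {T : measurableType d}.
Implicit Types (P : probability T R) (F : R -> set (set T)).
Implicit Types (G : set (set T)) (X M A V : R -> T -> R) (Y Z : T -> R).

Definition filtration F :=
  (forall t, 0 <= t -> sigma_algebra setT (F t) /\ F t `<=` d.-measurable) /\
  (forall s t, 0 <= s -> s <= t -> F s `<=` F t).

Definition usual_conditions P F :=
  [/\ measure_is_complete P,
      P.-negligible `<=` F 0 &
      forall t, 0 <= t -> \bigcap_(s in [set s | t < s]) F s = F t].

Definition measurable_wrt G Y :=
  forall B : set R, measurable B -> G (Y @^-1` B).

Definition adapted F X := forall t, 0 <= t -> measurable_wrt (F t) (X t).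

(* The predictable sigma-algebra on [0, +oo[ x T is generated by the sets
   {0} x B with B in F_0 and ]s, t] x B with B in F_s. *)
Definition predictable_rectangles F : set (set (R * T)) :=
  [set E | (exists2 B, F 0 B & E = [set 0] `*` B) \/
           (exists s t B, [/\ 0 <= s, s <= t, F s B & E = `]s, t] `*` B])].

Definition predictable_sigma_algebra F : set (set (R * T)) :=
  <<s [set p | 0 <= p.1], predictable_rectangles F >>.

Definition predictable F X :=
  forall B : set R, measurable B ->
    predictable_sigma_algebra F [set p | 0 <= p.1 /\ B (X p.1 p.2)].

Definition cadlag X := forall w, cadlag_path (X ^~ w).

Definition continuous_process X :=
  forall w, {within `[0, +oo[, continuous (X ^~ w)}.

Definition finite_variation X := forall w, finite_variation_path (X ^~ w).

Definition indistinguishable P X V :=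
  {ae P, forall w, forall t, 0 <= t -> X t w = V t w}.

Definition is_conditional_expectation P G Y Z :=
  [/\ measurable_wrt G Z, P.-integrable setT (EFin \o Z) &
      forall B, G B ->
        (\int[P]_(w in B) (Z w)%:E = \int[P]_(w in B) (Y w)%:E)%E].

Definition martingale P F M :=
  [/\ adapted F M,
      forall t, 0 <= t -> P.-integrable setT (EFin \o M t) &
      forall s t, 0 <= s -> s <= t ->
        is_conditional_expectation P (F s) (M t) (M s)].

Definition stopping_time F (tau : T -> \bar R) :=
  (forall w, (0 <= tau w)%E) /\
  (forall t, 0 <= t -> F t [set w | (tau w <= t%:E)%E]).

Definition stopped X (tau : T -> \bar R) : R -> T -> R :=
  fun t w => X (fine (Order.min t%:E (tau w))) w.

Definition local_martingale P F M :=
  adapted F M /\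
  exists tau : nat -> T -> \bar R,
    [/\ forall n, stopping_time F (tau n),
        {ae P, forall w, nondecreasing_seq (tau ^~ w) /\
                         tau ^~ w @ \oo --> +oo%E} &
        forall n, martingale P F (fun t w => stopped M (tau n) t w - M 0 w)].

(* Since A_{0-} = A_0, the condition A_{0-} = A_0 = 0 is just A_0 = 0. *)
Definition semimartingale_decomposition P F X M A :=
  [/\ adapted F X /\ cadlag X,
      [/\ local_martingale P F M, cadlag M & {ae P, forall w, M 0 w = 0}],
      [/\ adapted F A, cadlag A, predictable F A, finite_variation A &
          {ae P, forall w, A 0 w = 0}] &
      indistinguishable P X (fun t w => M t w + A t w)].

(* \int_0^t 1_{X_s != 0} dA_s = 0 and \int_0^t 1_{X_{s-} != 0} dA_s = 0 for all
   t >= 0, almost surely. *)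
Definition carried_by_zeros P X A :=
  {ae P, forall w, forall t, 0 <= t ->
    LS_integral (A ^~ w) \1_[set s | X s w != 0] t = 0}.

Definition carried_by_left_zeros P X A :=
  {ae P, forall w, forall t, 0 <= t ->
    LS_integral (A ^~ w) \1_[set s | left_limit_path (X ^~ w) s != 0] t = 0}.

Definition class_Sigma P F X :=
  exists M A, semimartingale_decomposition P F X M A /\ carried_by_zeros P X A.

End processes.

(* Main.v *)
Require Import Defs.
From mathcomp Require Import all_boot all_order all_algebra.
From mathcomp Require Import all_classical all_reals all_analysis.
From mathcomp Require Import measurable_realfun unstable.
From mathcomp Require Import ring lra.
Import Order.TTheory GRing.Theory Num.Theory.
Import numFieldNormedType.Exports.

Set Implicit Arguments.
Unset Strict Implicit.
Unset Printing Implicit Defensive.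

Local Open Scope classical_set_scope.
Local Open Scope ring_scope.

(** Write X = M + A and suppose first that A = C + V as in the second assertion.
    A cadlag path has countably many jumps ([countable_jumps]) and dV has no atoms
    because V is continuous, so that the indicators of {X_s <> 0} and of
    {X_s- <> 0} have the same integral against dV ([LS_integral_left_limit]). Hence
    dV, like dC, does not charge {X <> 0}, and neither does their sum
    ([LS_integral_indicD]).

    Conversely, class Sigma provides some decomposition X = M' + A' such that dA'
    does not charge {X <> 0}. With C = A and V = 0, everything reduces to A = A',
    the uniqueness of the decomposition ([decomposition_unique]): the process
    N = A - A' = M' - M, which is predictable, of finite variation and a local
    martingale null at 0, vanishes. By symmetry it is enough that N <= 0.

    - Localize by a time rho at which M and M' are stopped to martingales and before
      which the variation of N is bounded. The jump of N at rho is not bounded, but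
      it is integrable, since N stopped at rho is a martingale by optional stopping
      ([optional_stopping], [difference_localized], [localized_variation_le]).
      Optional stopping for cadlag martingales follows from the discrete case by
      rounding times up to finer and finer grids and by uniform integrability
      ([integral_limit_of_tail_bound], [optional_sampling]).
    - Hence the increasing and decreasing parts of dN up to rho define random
      measures of finite mean mass. By the martingale property they have the same
      mean on predictable rectangles, and so on every predictable set by the
      pi-lambda theorem ([predictable_agree_in_mean]).
    - The set {N > 0} is predictable. Therefore the integral of its indicator
      against dN up to rho has mean 0. But, path by path, this integral is at least
      the positive part of N at rho, by convexity of the positive part
      ([pos_part_le_stieltjes]). So N <= 0 at rho almost surely
      ([stopped_predictable_martingale_le0]), and the localizing times increase to
      infinity ([decomposition_le]). *)

(** * Grids and total variation along grids *)

Section grid.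
Context {R : realType}.
Implicit Types (u x y : R) (m i : nat) (a f : R -> R).

(** The grid of mesh u / (m + 1) on [0, u]. The index of x is the least i such
    that x lies at or below the i-th grid point, so that the two functions form a
    Galois connection ([grid_index_le]), from which their properties follow. *)
Definition grid_point u m i : R := u * i%:R / m.+1%:R.

Definition grid_index u m x : nat := `|Num.ceil (x * m.+1%:R / u)|%N.

Lemma grid_point0 u m : grid_point u m 0 = 0.
Proof. by rewrite /grid_point mulr0 mul0r. Qed.

Lemma grid_pointn u m : grid_point u m m.+1 = u.
Proof. by rewrite /grid_point mulfK// pnatr_eq0. Qed.

Lemma grid_pointS u m i : grid_point u m i.+1 = grid_point u m i + u / m.+1%:R.
Proof. by rewrite /grid_point -natr1 mulrDr mulr1 mulrDl. Qed.

Lemma grid_point_le u m i j : 0 <= u -> (i <= j)%N -> grid_point u m i <= grid_point u m j.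
Proof.
by move=> u0 ij; rewrite /grid_point ler_pM2r ?invr_gt0 ?ltr0n// ler_wpM2l// ler_nat.
Qed.

Lemma grid_point_ge0 u m i : 0 <= u -> 0 <= grid_point u m i.
Proof. by move=> u0; rewrite -(grid_point0 u m) grid_point_le. Qed.

Lemma grid_point_lt u m i j : 0 < u -> (i < j)%N -> grid_point u m i < grid_point u m j.
Proof.
by move=> u0 ij; rewrite /grid_point ltr_pM2r ?invr_gt0 ?ltr0n// ltr_pM2l// ltr_nat.
Qed.

Lemma grid_index_le u m x i : 0 < u -> 0 <= x -> (grid_index u m x <= i)%N = (x <= grid_point u m i).
Proof.
move=> u0 x0; have c0 : 0 <= Num.ceil (x * m.+1%:R / u).
  by rewrite ceil_ge0 (lt_le_trans (ltrN10 _))// divr_ge0 ?mulr_ge0// ltW.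
rewrite /grid_index /grid_point -lez_nat gez0_abs// ceil_le_int ler_pdivrMr//.
by rewrite ler_pdivlMr ?ltr0n// (mulrC u).
Qed.

Lemma grid_index_gt u m x i : 0 < u -> 0 <= x -> (i < grid_index u m x)%N = (grid_point u m i < x).
Proof. by move=> u0 x0; rewrite ltnNge grid_index_le// -ltNge. Qed.

Lemma grid_index_eq u m x i : 0 < u -> grid_point u m i < x -> x <= grid_point u m i.+1 ->
  grid_index u m x = i.+1.
Proof.
move=> u0 ix xi; have x0 : 0 <= x by apply/ltW/(le_lt_trans _ ix)/grid_point_ge0/ltW.
by apply/eqP; rewrite eqn_leq grid_index_le// xi /= grid_index_gt.
Qed.

Lemma grid_index_nondecreasing u m x y : 0 < u -> 0 <= x -> x <= y ->
  (grid_index u m x <= grid_index u m y)%N.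
Proof.
move=> u0 x0 xy; rewrite grid_index_le//; apply: (le_trans xy).
by rewrite -grid_index_le// (le_trans x0).
Qed.

Lemma grid_index0 u m : 0 < u -> grid_index u m 0 = 0%N.
Proof. by move=> u0; apply/eqP; rewrite -leqn0 grid_index_le// grid_point0. Qed.

Lemma grid_index_max u m x : 0 < u -> 0 <= x <= u -> (grid_index u m x <= m.+1)%N.
Proof. by move=> u0 /andP[x0 xu]; rewrite grid_index_le// grid_pointn. Qed.

(** The rounding of x up to the grid: rounding up, and not down, is what makes
    right continuity of a path sufficient for approximation along grids. *)
Definition grid_ceil u m x := grid_point u m (grid_index u m x).

Lemma grid_ceil_ge u m x : 0 < u -> 0 <= x -> x <= grid_ceil u m x.
Proof. by move=> u0 x0; rewrite /grid_ceil -grid_index_le. Qed.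

Lemma grid_ceil_le u m x : 0 < u -> 0 <= x -> grid_ceil u m x <= x + u / m.+1%:R.
Proof.
move=> u0 x0; rewrite /grid_ceil.
have := grid_index_gt m (grid_index u m x).-1 u0 x0.
case: (grid_index u m x) => [_|i]; first by rewrite grid_point0 addr_ge0// divr_ge0// ltW.
by rewrite ltnSn grid_pointS lerD2r => /esym/ltW.
Qed.

Lemma cvg_grid_ceil u x : 0 < u -> 0 <= x -> grid_ceil u m x @[m --> \oo] --> x.
Proof.
move=> u0 x0.
apply: (@squeeze_cvgr _ _ _ _ (cst x) (fun m => x + u / m.+1%:R)).
- by near=> m; rewrite grid_ceil_ge//= grid_ceil_le.
- exact: cvg_cst.
- rewrite -[X in _ --> X]addr0; apply: cvgD; first exact: cvg_cst.
  by rewrite -[X in _ --> X](mulr0 u); apply: cvgMr; exact: cvg_harmonic.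
Unshelve. all: by end_near. Qed.

Lemma right_cvg_seq f x (v : R^nat) : f s @[s --> x^'+] --> f x ->
  (forall n, x <= v n) -> v n @[n --> \oo] --> x -> f (v n) @[n --> \oo] --> f x.
Proof.
move=> fx xv vx; apply/cvgrPdist_lt => e e0.
have /cvgrPdist_lt/(_ _ e0) := fx.
case=> d /= d0 H.
have /cvgrPdist_lt/(_ _ d0) := vx; apply: filterS => n xvn.
have := xv n; rewrite le_eqVlt => /predU1P[<-|xvn']; first by rewrite subrr normr0.
by apply: H => //=.
Qed.

Lemma cvg_comp_grid_ceil f u x : 0 < u -> 0 <= x -> f s @[s --> x^'+] --> f x ->
  f (grid_ceil u m x) @[m --> \oo] --> f x.
Proof.
move=> u0 x0 fx; apply: right_cvg_seq => //; last exact: cvg_grid_ceil.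
by move=> n; exact: grid_ceil_ge.
Qed.

Definition grid_variation u m a : R :=
  \sum_(0 <= i < m.+1) `|a (grid_point u m i.+1) - a (grid_point u m i)|.

Lemma grid_variation_in_variations u m a : 0 < u -> variations 0 u a (grid_variation u m a).
Proof.
move=> u0; pose s := [seq grid_point u m i | i <- iota 1 m.+1].
have nthE i : (i <= m.+1)%N -> nth u (0 :: s) i = grid_point u m i.
  case: i => [|i]; first by rewrite grid_point0.
  by move=> im; rewrite /= (nth_map 0%N) ?size_iota// nth_iota.
exists s.
- split.
  + apply/(pathP u) => i; rewrite size_map size_iota => im.
    by rewrite nthE; [rewrite /s (nth_map 0%N) ?size_iota// nth_iota//;exact: grid_point_lt|exact: ltnW].
  + rewrite (last_nth u) size_map size_iota -/s.
    by rewrite nthE// grid_pointn.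
rewrite /variation /grid_variation size_map size_iota.
rewrite !big_mkord; apply: eq_bigr => i _ /=.
rewrite -/s -(nthE i.+1)// -(nthE i)//.
exact: ltnW.
Qed.

Lemma grid_increment_le u m a i j : (i <= j)%N ->
  `|a (grid_point u m j) - a (grid_point u m i)| <=
  \sum_(i <= k < j) `|a (grid_point u m k.+1) - a (grid_point u m k)|.
Proof.
move=> ij; rewrite -(telescope_sumr (fun k => a (grid_point u m k)))//.
exact: ler_norm_sum.
Qed.

Lemma variation_cons x u a y s :
  variation x u a (y :: s) = `|a y - a x| + variation y u a s.
Proof.
by rewrite /variation big_nat_recl//=; congr (_ + _).
Qed.

(** Sampled at rounded times, a path varies along a partition no more than along
    the whole grid, by the triangle inequality on each block of grid points. *)
Lemma grid_variation_partition u m a x s : 0 < u -> 0 <= x -> path <%O x s -> last x s = u ->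
  variation x u (a \o grid_ceil u m) s <=
  \sum_(grid_index u m x <= k < m.+1) `|a (grid_point u m k.+1) - a (grid_point u m k)|.
Proof.
move=> u0; elim: s x => [|y s ih] x x0 /=.
  by move=> _ ->; rewrite variation_nil sumr_ge0.
move=> /andP[xy ys] lastu; have y0 : 0 <= y by rewrite (le_trans x0)// ltW.
have yu : y <= u.
  by rewrite -lastu; exact: path_lt_le_last.
rewrite variation_cons.
rewrite (@big_cat_nat _ _ _ (grid_index u m y))//=.
- by rewrite lerD// ?ih//; apply: grid_increment_le; apply: grid_index_nondecreasing => //; exact: ltW.
- by apply: grid_index_nondecreasing => //; exact: ltW.
- by apply: grid_index_max => //; rewrite y0.
Qed.

Lemma cvg_variation (a' : nat -> R -> R) a u x s :
  (forall y, y \in x :: s -> a' m y @[m --> \oo] --> a y) ->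
  variation x u (a' m) s @[m --> \oo] --> variation x u a s.
Proof.
elim: s x => [|y s ih] x H.
  under eq_fun do rewrite variation_nil.
  by rewrite variation_nil; exact: cvg_cst.
under eq_fun do rewrite variation_cons.
rewrite variation_cons; apply: cvgD; last first.
  by apply: ih => z zs; apply: H; rewrite inE zs orbT.
apply: cvg_norm; apply: cvgB; apply: H; by rewrite !inE eqxx ?orbT.
Qed.

(** The total variation of a right-continuous path is a supremum over a fixed
    countable family of times, hence is measurable in a random parameter. *)
Lemma total_variation_grid u a : 0 < u ->
  (forall x, 0 <= x <= u -> a s @[s --> x^'+] --> a x) ->
  total_variation 0 u a = ereal_sup (range (fun m => (grid_variation u m a)%:E)).
Proof.
move=> u0 ra; apply/eqP; rewrite eq_le; apply/andP; split; last first.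
  apply: ge_ereal_sup => _ [m _ <-]; apply: ereal_sup_ubound.
  by exists (grid_variation u m a) => //; exact: grid_variation_in_variations.
apply: ge_ereal_sup => _ [_ [s [ps /eqP lastu] <-] <-].
set S := ereal_sup _.
have SS m : ((grid_variation u m a)%:E <= S)%E by apply: ereal_sup_ubound; exists m.
have cv : (fun m => (variation 0 u (a \o grid_ceil u m) s)%:E) @ \oo --> (variation 0 u a s)%:E.
  apply/cvg_EFin; first exact: nearW.
  apply: cvg_variation => y ys; apply: cvg_comp_grid_ceil => //.
    move: ys; rewrite inE => /predU1P[->//|].
    by move/(order_path_min lt_trans)/allP : ps => /[apply] /ltW.
  apply: ra; move: ys; rewrite inE => /predU1P[->|ys]; first by rewrite lexx ltW.
  move/(order_path_min lt_trans)/allP : (ps) => /(_ _ ys) /ltW -> /=.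
  rewrite -lastu; move: ps; case/splitPr : ys => s1 s2.
  rewrite cat_path last_cat/= => /and3P[_ _].
  exact: path_lt_le_last.
rewrite -(cvg_lim _ cv)//; apply: lime_le; first by apply: cvgP cv.
apply: nearW => m; apply: le_trans (SS m).
rewrite lee_fin; apply: le_trans (grid_variation_partition _ _ _ _ ps lastu) _ => //.
by rewrite grid_index0.
Qed.

End grid.

(** * Stieltjes integrals as limits of Riemann sums *)

Section riemann.
Context {R : realType}.
Implicit Types (u x y v : R) (m i : nat) (a f h : R -> R).

Let gitv v m i : set (measurableTypeR R) := `]grid_point v m i, grid_point v m i.+1]%classic.

Lemma grid_step h v m x : 0 < v -> 0 < x <= v ->
  h (grid_ceil v m x) = \sum_(i < m.+1) h (grid_point v m i.+1) * \1_(gitv v m i) x.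
Proof.
move=> v0 /andP[x0 xv].
have : (0 < grid_index v m x)%N by rewrite grid_index_gt ?grid_point0// ltW.
have : (grid_index v m x <= m.+1)%N by apply: grid_index_max => //; rewrite ltW.
have := @grid_ceil_ge _ v m x v0 (ltW x0).
have := grid_index_gt m (grid_index v m x).-1 v0 (ltW x0).
rewrite /grid_ceil; case E : (grid_index v m x) => [//|k] /=.
rewrite ltnSn => /esym kx xk; rewrite ltnS => km _.
rewrite (bigD1 (Ordinal (km : (k < m.+1)%N)))//= big1 ?addr0.
  have xI : gitv v m k x by rewrite /gitv/= in_itv/= kx xk.
  by rewrite indicE mem_set// mulr1.
move=> [i im] /= ik; suff xI : ~ gitv v m i x by rewrite indicE memNset// mulr0.
rewrite /gitv/= in_itv/= => /andP[ix xi].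
move/negP: ik; apply; apply/eqP/val_inj => /=.
by have := grid_index_eq v0 ix xi; rewrite E => -[].
Qed.

Lemma measurable_grid_step h v m : 0 < v ->
  measurable_fun (`]0, v]%classic : set (measurableTypeR R)) (h \o grid_ceil v m).
Proof.
move=> v0.
apply: (@eq_measurable_fun _ _ (measurableTypeR R) _ _ (fun x => \sum_(i < m.+1) h (grid_point v m i.+1) * \1_(gitv v m i) x)).
  by move=> x; rewrite inE/= in_itv/= => xv; rewrite -grid_step.
apply: measurable_sum => i; apply: measurable_funM; first exact: measurable_cst.
by apply: measurable_indic; exact: measurable_itv.
Qed.

Lemma measurable_right_continuous h v : 
  (forall x, 0 <= x <= v -> h s @[s --> x^'+] --> h x) ->
  measurable_fun (`]0, v]%classic : set (measurableTypeR R)) h.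
Proof.
move=> rh; have [v0|v0] := ltP 0 v; last first.
  rewrite set_itv_ge; first exact: measurable_fun_set0.
  by rewrite bnd_simp -leNgt.
apply: (@measurable_fun_cvg _ (measurableTypeR R) _ _ (fun m => h \o grid_ceil v m)).
  by move=> m; exact: measurable_grid_step.
move=> x /=; rewrite in_itv/= => /andP[x0 xv]; apply: cvg_comp_grid_ceil => //.
  exact: ltW.
by apply: rh; rewrite xv ltW.
Qed.

Lemma bounded_cvg_integral d (T : measurableType d) (mu : {measure set T -> \bar R})
  (D : set T) (h_ : nat -> T -> R) (h : T -> R) (k : R) :
  measurable D -> (mu D < +oo)%E -> (forall m, measurable_fun D (h_ m)) ->
  (forall m (x : T), D x -> `|h_ m x| <= k) ->
  (forall x : T, D x -> h_ m x @[m --> \oo] --> h x) ->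
  (\int[mu]_(x in D) (h_ m x)%:E)%E @[m --> \oo] --> (\int[mu]_(x in D) (h x)%:E)%E.
Proof.
move=> mD Doo mh hk hh.
apply: (@dominated_cvg _ _ _ _ _ _ (fun m => EFin \o h_ m) (EFin \o h) (cst k%:E)) => //.
- by move=> m; apply/measurable_EFinP.
- by move=> x Dx; apply/cvg_EFin; [exact: nearW|exact: hh].
- apply/integrableP; split; first exact: measurable_cst.
  by rewrite integral_cst// lte_mul_pinfty.
Qed.

Lemma stieltjes_measure_lty f x y : (stieltjes_measure f `]x, y]%classic < +oo)%E.
Proof.
have lsE (g : cumulative R R) :
    (lebesgue_stieltjes_measure g `]x, y]%classic < +oo)%E.
  rewrite /lebesgue_stieltjes_measure /measure_extension.
  rewrite measurable_mu_extE/=; last exact: is_ocitv.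
  by rewrite wlength_itv /=; case: ifP => // _; rewrite -EFinB ltry.
rewrite /stieltjes_measure; case: pselect => [H|_]; first exact: lsE.
exact: ltry.
Qed.

Lemma grid_step_integral h f v m : 0 < v ->
  nondecreasing f -> right_continuous f -> (forall x, 0 <= h x) ->
  (\int[stieltjes_measure f]_(x in `]0%R, v]) (h (grid_ceil v m x))%:E)%E =
  (\sum_(i < m.+1) h (grid_point v m i.+1) * (f (grid_point v m i.+1) - f (grid_point v m i)))%:E.
Proof.
move=> v0 ndf rf h0.
under eq_integral => x.
  rewrite inE/= in_itv/= => xv; rewrite grid_step//.
  rewrite -sumEFin.
  over.
rewrite ge0_integral_sum//; last 2 first.
- move=> i; apply/measurable_EFinP; apply: measurable_funM; first exact: measurable_cst.
  by apply: measurable_indic; exact: measurable_itv.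
- by move=> i x _; rewrite lee_fin mulr_ge0.
rewrite -sumEFin; apply: eq_bigr => i _.
under eq_integral do rewrite EFinM.
rewrite ge0_integralZl_EFin//; last first.
  apply/measurable_EFinP; apply: measurable_indic; exact: measurable_itv.
rewrite integral_indic//; last exact: measurable_itv.
rewrite EFinM; congr (_ * _)%E.
rewrite -stieltjes_measure_itv_oc//; last by apply: grid_point_le => //; exact: ltW.
congr (stieltjes_measure f _); apply/setIidPl => x; rewrite /gitv/= !in_itv/= => /andP[ix xi]; rewrite (le_lt_trans _ ix) ?grid_point_ge0 ?(ltW v0)//=.
by apply: (le_trans xi); rewrite -[leRHS](grid_pointn v m); apply: grid_point_le; [exact: ltW|].
Qed.

(** The integrand is sampled at the right end of each cell: right continuity then
    gives pointwise convergence of the step functions, and dominated convergence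
    concludes. *)
Lemma stieltjes_riemann_cvg h f v k : 0 < v ->
  nondecreasing f -> right_continuous f -> (forall x, 0 <= h x <= k) ->
  (forall x, 0 <= x <= v -> h s @[s --> x^'+] --> h x) ->
  \sum_(i < m.+1) h (grid_point v m i.+1) * (f (grid_point v m i.+1) - f (grid_point v m i)) @[m --> \oo]
  --> \int[stieltjes_measure f]_(x in `]0, v]) h x.
Proof.
move=> v0 ndf rf hk rh.
suff /fine_cvg : (\sum_(i < m.+1) h (grid_point v m i.+1) * (f (grid_point v m i.+1) - f (grid_point v m i)))%:E
  @[m --> \oo] --> (\int[stieltjes_measure f]_(x in `]0, v]) h x)%:E by [].
have h0 x : 0 <= h x by have /andP[] := hk x.
under eq_fun do rewrite -grid_step_integral//.
have fin : (\int[stieltjes_measure f]_(x in `]0%R, v]) (h x)%:E)%E \is a fin_num.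
  rewrite ge0_fin_numE; last first.
    by apply: integral_ge0 => x _; rewrite lee_fin.
  apply: (@le_lt_trans _ _ (\int[stieltjes_measure f]_(x in `]0%R, v]) (cst k%:E x))%E).
    apply: ge0_le_integral => //.
    - by move=> x _; rewrite lee_fin.
    - by apply/measurable_EFinP; exact: measurable_right_continuous.
    - by move=> x _; rewrite lee_fin; have /andP[] := hk x.
  rewrite integral_cst// lte_mul_pinfty//; last exact: stieltjes_measure_lty.
  by rewrite lee_fin; have /andP[] := hk 0; exact: le_trans.
rewrite /Rintegral fineK//.
apply: (bounded_cvg_integral (k := k)) => //.
- exact: stieltjes_measure_lty.
- by move=> m; exact: measurable_grid_step.
- by move=> m x _; rewrite ger0_norm//; have /andP[] := hk (grid_ceil v m x).
- move=> x /=; rewrite in_itv/= => /andP[x0 xv]; apply: cvg_comp_grid_ceil => //.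
    exact: ltW.
  by apply: rh; rewrite xv ltW.
Qed.

End riemann.

(** * The positive part of a path of finite variation *)

Section positive_part.
Context {R : realType}.
Implicit Types (w z v : R) (a p n : R -> R).

(* The hinge is a continuous approximation of the indicator of the positive
   reals: hinge (k w) increases to it as k grows. Its primitive hingeI is convex. *)
Let hinge w : R := Num.min 1 (Num.max 0 w).

Let hingeI w : R := if w <= 0 then 0 else if w <= 1 then w ^+ 2 / 2 else w - 2^-1.

Let hinge_ge0 w : 0 <= hinge w.
Proof. by rewrite /hinge le_min ler01 le_max lexx. Qed.

Let hinge_le1 w : hinge w <= 1.
Proof. by rewrite /hinge ge_min lexx. Qed.

Let hingeI_ge0 w : 0 <= hingeI w.
Proof.
rewrite /hingeI; case: ifPn => // _; case: ifPn => [_|]; first by rewrite divr_ge0// sqr_ge0.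
rewrite -ltNge => w1; lra.
Qed.

Let hingeI_ge w : w - 2^-1 <= hingeI w.
Proof.
rewrite /hingeI; case: ifPn => [w0|_]; first lra.
case: ifPn => // _.
by rewrite -subr_ge0 (_ : _ - _ = (w - 1) ^+ 2 / 2) ?divr_ge0 ?sqr_ge0//; field.
Qed.

Let hinge_convex z w : hingeI z - hingeI w <= hinge z * (z - w).
Proof.
rewrite /hinge; case: (leP z 0) => [z0|z0].
  have -> : hingeI z = 0 by rewrite /hingeI z0.
  rewrite (min_idPr ler01) mul0r sub0r oppr_le0.
  exact: hingeI_ge0.
case: (leP 1 z) => [z1|z1].
  have -> : hingeI z = z - 2^-1.
    rewrite /hingeI leNgt z0/=; case: ifPn => // z1'.
    by have -> : z = 1 by [apply/eqP; rewrite eq_le z1 z1']; rewrite expr1n; lra.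
  by have := hingeI_ge w; lra.
have -> : hingeI z = z ^+ 2 / 2 by rewrite /hingeI leNgt z0/= (ltW z1).
rewrite /hingeI.
case: ifPn => [w0|]; first nra.
rewrite -ltNge => w0; case: ifPn => [w1|].
  by rewrite -subr_ge0 (_ : _ - _ = (z - w) ^+ 2 / 2) ?divr_ge0 ?sqr_ge0//; field.
rewrite -ltNge => w1.
rewrite -subr_ge0 (_ : _ - _ = (1 - z) * (w - (1 + z) / 2)); last by field.
by apply: mulr_ge0; lra.
Qed.

Let cvg_hinge (F : set_system R) (FF : Filter F) (f : R -> R) w :
  f x @[x --> F] --> w -> hinge (f x) @[x --> F] --> hinge w.
Proof.
move=> fw; apply: (cvg_comp _ _ fw).
apply: continuous_min; first exact: cvg_cst.
by apply: continuous_max; [exact: cvg_cst|exact: cvg_id].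
Qed.

(** The right-hand side is the integral of the indicator of {a > 0} against da.
    For a convex function f with derivative f', each increment satisfies
    f (a t) - f (a s) <= f' (a t) (a t - a s); summing over a grid and passing to
    the limit with f' = hinge (k .), then letting k tend to infinity, gives the
    bound. At a jump of a across 0 the inequality is strict, which is why only an
    inequality can hold. *)
Lemma pos_part_le_stieltjes a p n v : 0 < v ->
  nondecreasing p -> right_continuous p ->
  nondecreasing n -> right_continuous n ->
  (forall x, 0 <= x -> a x = p x - n x) ->
  (forall x, 0 <= x -> a s @[s --> x^'+] --> a x) -> a 0 <= 0 ->
  Num.max 0 (a v) <=
    fine (stieltjes_measure p ([set s | 0 < a s] `&` `]0, v])) -
    fine (stieltjes_measure n ([set s | 0 < a s] `&` `]0, v])).
Proof.
move=> v0 ndp rp ndn rn apn ra a0.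
pose h k s := hinge (k.+1%:R * a s).
have h01 k s : 0 <= h k s <= 1 by rewrite hinge_ge0 hinge_le1.
have rh k x : 0 <= x <= v -> h k s @[s --> x^'+] --> h k x.
  move=> /andP[x0 _]; apply: cvg_hinge; apply: cvgMr; exact: ra.
pose I f k := \int[stieltjes_measure f]_(x in `]0, v]) h k x.
(* The primitive of hinge (k .) is at least 0 and at least w - 1 / (2 k). *)
have I_ge k : Num.max 0 (a v) - 2^-1 * k.+1%:R^-1 <= I p k - I n k.
  have k0 : 0 < k.+1%:R :> R by [].
  apply: (@le_trans _ _ (hingeI (k.+1%:R * a v) / k.+1%:R)).
    rewrite lerBlDr ge_max; apply/andP; split.
      by rewrite addr_ge0// mulr_ge0// invr_ge0 ltW.
    have := hingeI_ge (k.+1%:R * a v).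
    rewrite -(ler_pM2r (x := k.+1%:R^-1)) ?invr_gt0// mulrBl mulrAC divff ?gt_eqF//.
    by rewrite mul1r lerBlDr.
  have cI := cvgB (stieltjes_riemann_cvg v0 ndp rp (h01 k) (rh k))
    (stieltjes_riemann_cvg v0 ndn rn (h01 k) (rh k)).
  apply: (ler_cvg_to (cvg_cst _) (cI _)); apply: nearW => m /=.
  rewrite [leRHS]/GRing.add /= -sumrB.
  rewrite ler_pdivrMr//.
  have {1}-> : a v = a (grid_point v m m.+1) by rewrite grid_pointn.
  apply: (@le_trans _ _ (hingeI (k.+1%:R * a (grid_point v m m.+1)) - hingeI (k.+1%:R * a (grid_point v m 0)))).
    rewrite grid_point0 [hingeI (_ * a 0)](_ : _ = 0) ?subr0// /hingeI ifT//.
    by rewrite pmulr_rle0.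
  rewrite -(telescope_sumr (fun i => hingeI (k.+1%:R * a (grid_point v m i))))// big_mkord mulr_suml.
  apply: ler_sum => i _; apply: (le_trans (hinge_convex _ _)).
  rewrite -!mulrBr -!mulrA ler_wpM2l// mulrC ler_wpM2r ?ler0n//.
  rewrite !apn ?grid_point_ge0 ?(ltW v0)//.
  by rewrite le_eqVlt; apply/orP; left; apply/eqP; ring.
have mh k : measurable_fun (`]0, v]%classic : set (measurableTypeR R)) (h k).
  by apply: measurable_right_continuous => x; exact: rh.
have mpos : measurable ([set s | 0 < a s] `&` `]0, v] : set (measurableTypeR R)).
  have ma : measurable_fun (`]0, v]%classic : set (measurableTypeR R)) a.
    by apply: measurable_right_continuous => x /andP[x0 _]; exact: ra.
  have := ma (measurable_itv _) `]0, +oo[%classic (measurable_itv _).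
  rewrite setIC; congr measurable; congr (_ `&` _); apply/seteqP.
  by split => x /=; rewrite in_itv/= andbT.
have cI f : I f @ \oo --> fine (stieltjes_measure f ([set s | 0 < a s] `&` `]0, v])).
  suff : (\int[stieltjes_measure f]_(x in `]0%R, v]) (h k x)%:E)%E @[k --> \oo] -->
      (fine (stieltjes_measure f ([set s | 0 < a s] `&` `]0, v])))%:E.
    by move/fine_cvg.
  rewrite fineK; last first.
    rewrite ge0_fin_numE//; apply: le_lt_trans (stieltjes_measure_lty f 0 v).
    by apply: le_measure; rewrite ?inE//; exact: measurable_itv.
  have -> : [set s | 0 < a s] `&` `]0, v] =
      ([set s | 0 < a s] `&` `]0, v]) `&` `]0, v] by rewrite -setIA setIid.
  rewrite -integral_indic//.
  apply: (bounded_cvg_integral (k := 1)) => //.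
  - exact: stieltjes_measure_lty.
  - by move=> k x _; have /andP[hx h1] := h01 k x; rewrite ger0_norm.
  - move=> x xv; rewrite indicE; have [ax|ax] := ltP 0 (a x).
      rewrite mem_set//; apply: cvg_near_cst; near=> k.
      rewrite /h /hinge (max_idPr _) ?mulr_ge0// ?ltW//; apply/min_idPl.
      rewrite -ler_pdivrMr//; apply: (@le_trans _ _ k%:R); last by rewrite ler_nat.
      by near: k; exact: nbhs_infty_ger.
    rewrite memNset/=; last by move=> [+ _]; apply/negP; rewrite -leNgt.
    apply: cvg_near_cst; apply: nearW => k.
    by rewrite /h /hinge (max_idPl _) ?(min_idPr _)// pmulr_rle0.
have cV : (fun k => Num.max 0 (a v) - 2^-1 * k.+1%:R^-1) @ \oo --> Num.max 0 (a v).
  rewrite -[X in _ --> X]subr0 -[X in _ - X](mulr0 2^-1).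
  by apply: cvgB; [exact: cvg_cst|apply: cvgMr; exact: cvg_harmonic].
apply: (ler_cvg_to cV (cvgB (cI p) (cI n))); exact: nearW.
Unshelve. all: by end_near. Qed.

End positive_part.

(** * Jordan decomposition of paths *)

Section jordan.
Context {R : realType}.
Implicit Types (s t : R) (a b : R -> R).

Lemma jordan_path a t : finite_variation_path a -> 0 <= t ->
  a t = pos_part_path a t - neg_part_path a t.
Proof.
move=> fa t0; rewrite /pos_part_path /neg_part_path (max_idPr t0).
by apply: (bounded_variation_pos_neg_tvE (fa _ t0)); rewrite in_itv/= t0 lexx.
Qed.

Lemma neg_part_pathE a t : finite_variation_path a -> 0 <= t ->
  neg_part_path a t = (fine (total_variation 0 t a) - a t) / 2.
Proof.
move=> fa t0; rewrite /neg_part_path (max_idPr t0) /neg_tv.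
have fin : total_variation 0 t a \is a fin_num by apply/bounded_variationP => //; exact: fa.
by rewrite fineM ?fin_numB ?fin//= fineD.
Qed.

Lemma pos_part_pathE a t : finite_variation_path a -> 0 <= t ->
  pos_part_path a t = (fine (total_variation 0 t a) + a t) / 2.
Proof.
move=> fa t0; rewrite -[LHS]/(neg_part_path (\- a) t).
rewrite neg_part_pathE//; last exact: finite_variation_pathN.
by rewrite total_variationN opprK.
Qed.

Lemma le_norm_total_variation a t : finite_variation_path a -> 0 <= t ->
  `|a t - a 0| <= fine (total_variation 0 t a).
Proof.
move=> fa t0; rewrite -lee_fin fineK; first exact: total_variation_ge.
by apply/bounded_variationP => //; exact: fa.
Qed.

Lemma neg_part_path_incr a t : finite_variation_path a -> 0 <= t ->
  neg_part_path a t - neg_part_path a 0 <= fine (total_variation 0 t a).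
Proof.
move=> fa t0; rewrite !neg_part_pathE// total_variationxx/=.
have := le_norm_total_variation fa t0; rewrite ler_norml => /andP[]; lra.
Qed.

Lemma pos_part_path_incr a t : finite_variation_path a -> 0 <= t ->
  pos_part_path a t - pos_part_path a 0 <= fine (total_variation 0 t a).
Proof.
move=> fa t0; rewrite !pos_part_pathE// total_variationxx/=.
have := le_norm_total_variation fa t0; rewrite ler_norml => /andP[]; lra.
Qed.

(** A path can only exceed the variation bound k on [0, t[ by its jump at t, and
    this jump is controlled by the value at t: if that value is integrable, so is
    the variation on [0, t]. *)
Lemma total_variation_jump_le a t k : finite_variation_path a -> 0 < t ->
  (forall s, 0 <= s < t -> fine (total_variation 0 s a) <= k) ->
  fine (total_variation 0 t a) <= k + k + `|a 0| + `|a t|.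
Proof.
move=> fa t0 H; have fin s : 0 <= s -> total_variation 0 s a \is a fin_num.
  by move=> s0; apply/bounded_variationP => //; exact: fa.
rewrite -lee_fin fineK; last by apply: fin; exact: ltW.
apply: ge_ereal_sup => _ [_ [s [ps /eqP lasts] <-] <-].
elim/last_ind: s ps lasts => [_ /= t0'|s x _]; first by move: t0; rewrite t0' ltxx.
rewrite rcons_path last_rcons => /andP[ps sx] xt; rewrite {}xt {x} in sx *.
set c := last 0 s in sx; have c0 : 0 <= c by exact: path_lt_le_last.
rewrite -cats1 (variation_cat _ c0 (ltW sx)); last 2 first.
- by split => //.
- exact: itv_partition1.
have ck : variation 0 c a s <= k.
  apply: le_trans (H c _); last by rewrite c0.
  rewrite -lee_fin fineK; last exact: fin.
  apply: ereal_sup_ubound; exists (variation 0 c a s) => //.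
  by exists s.
have ac := le_norm_total_variation fa c0.
have := H _ (introT andP (conj c0 sx)).
rewrite lee_fin variation_cons variation_nil addr0 => tvk.
have : `|a t - a c| <= `|a t| + (`|a c - a 0| + `|a 0|).
  apply: (le_trans (ler_normB _ _)); rewrite lerD2l.
  by rewrite -{1}[a c](subrK (a 0)) ler_normD.
move: ck ac tvk; lra.
Qed.

Lemma eq_total_variation a b t : (forall s, 0 <= s -> a s = b s) ->
  total_variation 0 t a = total_variation 0 t b.
Proof.
move=> ab; rewrite /total_variation; congr (ereal_sup (EFin @` _)).
have E (s : seq R) : itv_partition 0 t s -> variation 0 t a s = variation 0 t b s.
  move=> [ps /eqP lasts]; rewrite /variation !big_mkord; apply: eq_bigr => -[i /= si] _.
  have pos j : (j <= size s)%N -> 0 <= nth t (0 :: s) j.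
    move=> js; have : nth t (0 :: s) j \in 0 :: s by apply: mem_nth.
    rewrite inE => /predU1P[->//|].
    by move/(order_path_min lt_trans)/allP : ps => /[apply] /ltW.
  by congr (`|_ - _|); apply: ab; [exact: (pos i.+1)|exact/pos/ltnW].
by apply/seteqP; split => x [s ps <-]; exists s => //; rewrite E.
Qed.

Lemma eq_neg_part_path a b : (forall s, 0 <= s -> a s = b s) ->
  neg_part_path a = neg_part_path b.
Proof.
move=> ab; apply/funext => s; rewrite /neg_part_path /neg_tv.
by rewrite (eq_total_variation _ ab) ab// le_max lexx.
Qed.

Lemma eq_pos_part_path a b : (forall s, 0 <= s -> a s = b s) ->
  pos_part_path a = pos_part_path b.
Proof. by move=> ab; apply: eq_neg_part_path => s s0 /=; rewrite ab. Qed.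

Lemma eq_LS_integral a b h t : (forall s, 0 <= s -> a s = b s) ->
  LS_integral a h t = LS_integral b h t.
Proof.
by move=> ab; rewrite /LS_integral (eq_pos_part_path ab) (eq_neg_part_path ab).
Qed.

End jordan.

(** * Passing to the limit under uniform integrability *)

Lemma Rintegral_dominated_cvg {R : realType} d {T : measurableType d}
  (mu : {measure set T -> \bar R}) (D : set T) (h_ : nat -> T -> R) (h g : T -> R) :
  measurable D -> (forall m, measurable_fun D (h_ m)) ->
  mu.-integrable D (EFin \o g) ->
  (forall m (x : T), D x -> `|h_ m x| <= g x) ->
  (forall x : T, D x -> h_ m x @[m --> \oo] --> h x) ->
  \int[mu]_(x in D) h_ m x @[m --> \oo] --> \int[mu]_(x in D) h x.
Proof.
move=> mD mh ig hg hh.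
have mh' : measurable_fun D h by apply: (measurable_fun_cvg mh).
have hg' x : D x -> `|h x| <= g x.
  move=> Dx; have ch := cvg_norm (hh _ Dx).
  by apply: (ler_cvg_to (ch _) (cvg_cst _)); apply: nearW => m; exact: hg.
have fin : (\int[mu]_(x in D) (h x)%:E)%E \is a fin_num.
  apply: integrable_fin_num => //; apply: (le_integrable mD _ _ ig).
    exact/measurable_EFinP.
  by move=> x Dx /=; rewrite lee_fin (le_trans (hg' _ Dx))// ler_norm.
suff : (\int[mu]_(x in D) (h_ m x)%:E)%E @[m --> \oo] -->
    (fine (\int[mu]_(x in D) (h x)%:E)%E)%:E by move/fine_cvg.
rewrite fineK//.
apply: (@dominated_cvg _ _ _ _ _ mD (fun m => EFin \o h_ m) (EFin \o h) (EFin \o g)) => //.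
- by move=> m; exact/measurable_EFinP.
- by move=> x Dx; apply/cvg_EFin; [exact: nearW|exact: hh].
Qed.

Section uniform_integrability.
Context {R : realType} d {T : measurableType d} (mu : {finite_measure set T -> \bar R}).
Implicit Types (c z : R) (B : set T) (Y Z : T -> R).

(* Truncation at level c, and a continuous majorant of the indicator of
   {|z| > c} that tends to 0 as c tends to infinity. *)
Let clip c z : R := Num.max (- c) (Num.min c z).

Let tail c z : R := Num.min 1 (`|z| / c).

Let clip_le c z : 0 <= c -> `|clip c z| <= c.
Proof.
move=> c0; rewrite /clip ler_norml le_max lexx/= ge_max ge_min lexx/= andbT.
by rewrite (le_trans _ c0)// oppr_le0.
Qed.

Let clip_id c z : `|z| <= c -> clip c z = z.
Proof.
by rewrite ler_norml => /andP[zc cz]; rewrite /clip (min_idPr cz); apply/max_idPr.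
Qed.

Let norm_clip_le c z : 0 <= c -> `|clip c z| <= `|z|.
Proof.
move=> c0; have [zc|zc] := leP `|z| c; first by rewrite clip_id.
by rewrite (le_trans (clip_le _ c0))// ltW.
Qed.

Let clip_tail_le c z : 0 <= c -> `|z - clip c z| <= `|z|.
Proof.
move=> c0; have [zc|cz] := leP `|z| c; first by rewrite clip_id// subrr normr0.
move: cz; rewrite /clip; have [z0|z0] := leP 0 z.
  rewrite ger0_norm// => cz; rewrite (min_idPl (ltW cz)) (max_idPr _).
    by rewrite ger0_norm ?subr_ge0 ?(ltW cz)// gerBl.
  by rewrite (le_trans _ c0)// oppr_le0.
rewrite ltr0_norm// => cz; rewrite (min_idPr _); last by rewrite (le_trans (ltW z0)).
rewrite (max_idPl _); last by rewrite lerNr ltW.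
rewrite opprK ler0_norm; first by rewrite opprD gerDl oppr_le0.
by move: cz; lra.
Qed.

Let tail_ge0 c z : 0 < c -> 0 <= tail c z <= 1.
Proof. by move=> c0; rewrite /tail le_min ge_min lexx/= ler01/= andbT divr_ge0// ltW. Qed.

Let tail1 c z : 0 < c -> c < `|z| -> tail c z = 1.
Proof.
by move=> c0 cz; rewrite /tail; apply/min_idPl; rewrite ler_pdivlMr// mul1r ltW.
Qed.

Let cvg_clip c (F : set_system nat) (FF : Filter F) (f : nat -> R) z :
  f x @[x --> F] --> z -> clip c (f x) @[x --> F] --> clip c z.
Proof.
move=> fz; apply: (cvg_comp _ _ fz).
apply: (@continuous_max R R (cst (- c)) (fun y => Num.min c y)); first exact: cvg_cst.
by apply: (@continuous_min R R (cst c) id); [exact: cvg_cst|exact: cvg_id].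
Qed.

Let cvg_tail c (F : set_system nat) (FF : Filter F) (f : nat -> R) z :
  f x @[x --> F] --> z -> tail c (f x) @[x --> F] --> tail c z.
Proof.
move=> fz; apply: (cvg_comp _ _ fz).
apply: (@continuous_min R R (cst 1) (fun y => `|y| / c)); first exact: cvg_cst.
by apply: cvgMl; exact: norm_continuous.
Qed.

Let measurable_clip c Z : measurable_fun setT Z -> measurable_fun setT (clip c \o Z).
Proof.
move=> mZ; apply: measurable_maxr => //; exact: measurable_minr.
Qed.

Let measurable_tail c Z : measurable_fun setT Z -> measurable_fun setT (tail c \o Z).
Proof.
move=> mZ; apply: measurable_minr => //; apply: measurable_funM => //.
exact: measurableT_comp.
Qed.


Let finite_measure_bounded_integrable (k : R) Y : measurable_fun setT Y ->
  (forall x, `|Y x| <= k) -> mu.-integrable setT (EFin \o Y).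
Proof.
move=> mY Yk; apply: (@le_integrable _ _ _ _ _ _ _ (EFin \o cst k)) => //.
- exact/measurable_EFinP.
- by move=> x _ /=; rewrite lee_fin (le_trans (Yk x))// ler_norm.
- exact: finite_measure_integrable_cst.
Qed.

Let limit_integrable (Z_ : nat -> T -> R) Z Y :
  mu.-integrable setT (EFin \o Y) ->
  (forall m, mu.-integrable setT (EFin \o Z_ m)) ->
  (forall x, Z_ m x @[m --> \oo] --> Z x) ->
  (forall m, (\int[mu]_x `|(Z_ m x)%:E| <= \int[mu]_x `|(Y x)%:E|)%E) ->
  mu.-integrable setT (EFin \o Z).
Proof.
move=> iY iZ ZZ ZY; have mZ m : measurable_fun setT (Z_ m).
  by apply/measurable_EFinP; case/integrableP : (iZ m).
have cvZ x : `|(Z_ m x)%:E|%E @[m --> \oo] --> `|(Z x)%:E|%E.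
  by apply: cvg_abse; apply/cvg_EFin; [exact: nearW|exact: ZZ].
apply/integrableP; split.
  by apply/measurable_EFinP; apply: (measurable_fun_cvg mZ) => x _; exact: ZZ.
apply: (@le_lt_trans _ _ (\int[mu]_x `|(Y x)%:E|)%E); last by case/integrableP : iY.
have -> : (\int[mu]_x `|(EFin \o Z) x| =
    \int[mu]_x limn_einf (fun m => `|(Z_ m x)%:E|))%E.
  by apply: eq_integral => x _; rewrite (cvg_limn_einf_sup (cvZ _)).1.
apply: (le_trans (fatou mu measurableT _ _)).
- by move=> m; apply: measurableT_comp => //; exact/measurable_EFinP.
- by move=> m x _; exact: abse_ge0.
rewrite limn_einf_lim; apply: lime_le; first exact: is_cvg_einfs.
apply: nearW => m; apply: le_trans (ZY m); apply: ereal_inf_lbound.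
by exists m => /=.
Qed.

(** The tail bound holds when Z_m is a conditional expectation of Y, as in optional
    sampling, and makes the sequence uniformly integrable. Clipping at level c
    changes the integral of Z_m by at most the integral of |Y| tail c Z_m; both
    the clipped integral and this bound converge as m tends to infinity by
    dominated convergence, and the bound vanishes as c tends to infinity. *)
Lemma integral_limit_of_tail_bound (Z_ : nat -> T -> R) Z Y B e : measurable B ->
  mu.-integrable setT (EFin \o Y) ->
  (forall m, mu.-integrable setT (EFin \o Z_ m)) ->
  (forall x, Z_ m x @[m --> \oo] --> Z x) ->
  (forall m, \int[mu]_(x in B) Z_ m x = e) ->
  (forall m c, 0 <= c -> \int[mu]_(x in [set x | c < `|Z_ m x|]) `|Z_ m x| <=
                        \int[mu]_(x in [set x | c < `|Z_ m x|]) `|Y x|) ->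
  mu.-integrable setT (EFin \o Z) /\ \int[mu]_(x in B) Z x = e.
Proof.
move=> mB iY iZ ZZ ZB tailZ.
have mZ m : measurable_fun setT (Z_ m).
  by apply/measurable_EFinP; case/integrableP : (iZ m).
have mY : measurable_fun setT Y by apply/measurable_EFinP; case/integrableP : iY.
have mZ' : measurable_fun setT Z.
  by apply: (measurable_fun_cvg mZ) => x _; exact: ZZ.
have inY := integrable_norm iY.
have mtail m c : measurable [set x | c < `|Z_ m x|].
  have : measurable_fun setT (fun x => `|Z_ m x|) by exact: measurableT_comp.
  move=> /(_ measurableT `]c, +oo[%classic (measurable_itv _)); rewrite setTI.
  by congr measurable; apply/seteqP; split => x /=; rewrite in_itv/= andbT.
have ipatch f D : measurable D -> mu.-integrable setT (EFin \o f) ->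
    mu.-integrable setT (EFin \o (f \_ D)).
  move=> mD /(integrableS measurableT mD (@subsetT _ _)).
  by move/(integrable_mkcond _ mD); rewrite restrict_EFin.
have iZ' : mu.-integrable setT (EFin \o Z).
  apply: (limit_integrable iY iZ ZZ) => m.
  have inZ := integrable_norm (iZ m).
  rewrite -(fineK (integrable_fin_num measurableT inZ)).
  rewrite -(fineK (integrable_fin_num measurableT inY)) lee_fin.
  have := tailZ m 0 (lexx _).
  rewrite [leLHS]Rintegral_mkcond [X in X <= _](_ : _ = \int[mu]_x `|Z_ m x|); last first.
    apply: eq_Rintegral => x _; rewrite patchE; case: ifPn => //.
    rewrite notin_setE/= => /negP; rewrite -leNgt => Z0.
    by apply/eqP; rewrite eq_sym eq_le Z0 normr_ge0.
  move=> /le_trans; apply; rewrite Rintegral_mkcond; apply: le_Rintegral => //.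
    exact: ipatch.
  by move=> x _; rewrite patchE; case: ifPn => _ //=; exact: normr_ge0.
split => //.
have inYt c V : 0 < c -> measurable_fun setT V ->
    mu.-integrable setT (EFin \o (fun x => `|Y x| * tail c (V x))).
  move=> c0 mV; apply: (@le_integrable _ _ _ _ _ _ _ (EFin \o Y)) => //.
    apply/measurable_EFinP; apply: measurable_funM; last exact: measurable_tail.
    exact: measurableT_comp.
  move=> x _; rewrite lee_fin; have /andP[t0 t1] := tail_ge0 (V x) c0.
  by rewrite ger0_norm ?mulr_ge0// ler_piMr.
have iclip c V : 0 < c -> measurable_fun setT V -> mu.-integrable setT (EFin \o (clip c \o V)).
  move=> c0 mV; apply: (@finite_measure_bounded_integrable c); first exact: measurable_clip.
  by move=> x; apply: clip_le; exact: ltW.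
have iB f : mu.-integrable setT (EFin \o f) -> mu.-integrable B (EFin \o f).
  by move=> /(integrableS measurableT mB (@subsetT _ _)).
have key m c : 0 < c -> `|e - \int[mu]_(x in B) clip c (Z_ m x)| <=
    \int[mu]_x (`|Y x| * tail c (Z_ m x)).
  move=> c0; rewrite -(ZB m) -RintegralB//; [|exact: iB|exact/iB/iclip].
  have iZc : mu.-integrable setT (EFin \o (fun x => Z_ m x - clip c (Z_ m x))).
    by have := integrableB measurableT (iZ m) (iclip _ _ c0 (mZ m)).
  apply: (le_trans (le_normr_Rintegral mB (iB _ iZc))).
  apply: (@le_trans _ _ (\int[mu]_(x in [set x | c < `|Z_ m x|]) `|Z_ m x|)).
    rewrite [leLHS]Rintegral_mkcond [leRHS]Rintegral_mkcond; apply: le_Rintegral => //.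
    - by apply: ipatch => //; exact: integrable_norm.
    - by apply: ipatch => //; exact: integrable_norm.
    - move=> x _; rewrite !patchE; case: ifPn => _; case: ifPn => //= Zc; [|
        |exact: normr_ge0]; first by apply: clip_tail_le; exact: ltW.
      move: Zc; rewrite notin_setE/= => /negP; rewrite -leNgt => /clip_id ->.
      by rewrite subrr normr0.
  apply: (le_trans (tailZ _ _ (ltW c0))); rewrite [leLHS]Rintegral_mkcond.
  apply: le_Rintegral => //; [exact: ipatch|exact: inYt|].
  move=> x _; rewrite patchE; case: ifPn; first by rewrite inE/= => /tail1 ->//; rewrite mulr1.
  by have /andP[t0 _] := tail_ge0 (Z_ m x) c0; rewrite mulr_ge0.
have key2 c : 0 < c -> `|e - \int[mu]_(x in B) clip c (Z x)| <=
    \int[mu]_x (`|Y x| * tail c (Z x)).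
  move=> c0.
  have cl : \int[mu]_(x in B) clip c (Z_ m x) @[m --> \oo] --> \int[mu]_(x in B) clip c (Z x).
    apply: (Rintegral_dominated_cvg (g := cst c)) => //.
    - by move=> m; apply: measurable_funTS; exact: measurable_clip.
    - exact: finite_measure_integrable_cst.
    - by move=> m x _; apply: clip_le; exact: ltW.
    - by move=> x _; exact: cvg_clip.
  have ct : \int[mu]_x (`|Y x| * tail c (Z_ m x)) @[m --> \oo] -->
      \int[mu]_x (`|Y x| * tail c (Z x)).
    apply: (Rintegral_dominated_cvg (g := fun x => `|Y x|)) => //.
    - move=> m; apply: measurable_funM; last exact: measurable_tail.
      exact: measurableT_comp.
    - move=> m x _; have /andP[t0 t1] := tail_ge0 (Z_ m x) c0.
      by rewrite ger0_norm ?mulr_ge0// ler_piMr.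
    - by move=> x _; apply: cvgMr; exact: cvg_tail.
  have cn := cvg_norm (cvgB (cvg_cst e) cl).
  by apply: (ler_cvg_to (cn _ _ _) ct); apply: nearW => m; exact: key.
have cl : \int[mu]_(x in B) clip k.+1%:R (Z x) @[k --> \oo] --> \int[mu]_(x in B) Z x.
  apply: (Rintegral_dominated_cvg (g := fun x => `|Z x|)) => //.
  - by move=> m; apply: measurable_funTS; exact: measurable_clip.
  - exact/iB/integrable_norm.
  - by move=> m x _; exact: norm_clip_le.
  - move=> x _; apply: cvg_near_cst; near=> k; apply: clip_id.
    apply: (@le_trans _ _ k%:R); last by rewrite ler_nat.
    by near: k; exact: nbhs_infty_ger.
have ct : \int[mu]_x (`|Y x| * tail k.+1%:R (Z x)) @[k --> \oo] --> \int[mu]_(x in [set: T]) (0 : R).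
  apply: (Rintegral_dominated_cvg (g := fun x => `|Y x|)) => //.
  - move=> m; apply: measurable_funM; last exact: measurable_tail.
    exact: measurableT_comp.
  - move=> m x _; have /andP[t0 t1] := @tail_ge0 m.+1%:R (Z x) (ltr0Sn _ _).
    by rewrite ger0_norm ?mulr_ge0// ler_piMr.
  - move=> x _; rewrite -[X in _ --> X](mulr0 `|Y x|); apply: cvgMr.
    have -> : 0 = Num.min 1 (`|Z x| * 0) :> R by rewrite mulr0; apply/esym/min_idPr.
    apply: (cvg_comp (G := nbhs (`|Z x| * 0)) (fun k : nat => `|Z x| * k.+1%:R^-1) (fun y => Num.min 1 y)).
      by apply: cvgMr; exact: cvg_harmonic.
    by apply: (@continuous_min R R (cst 1) id); [exact: cvg_cst|exact: cvg_id].
rewrite Rintegral_cst// mul0r in ct.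
have cn := cvg_norm (cvgB (cvg_cst e) cl).
apply/eqP; rewrite eq_sym -subr_eq0 -normr_le0.
by apply: (ler_cvg_to (cn _ _ _) ct); apply: nearW => k; exact: key2.
Unshelve. all: by end_near. Qed.

End uniform_integrability.

(** * Optional sampling at bounded random times *)

Section filtrations.
Context {R : realType} {d : measure_display} {T : measurableType d}.
Variables (P : probability T R) (F : R -> set (set T)).
Hypothesis filtF : filtration F.
Implicit Types (B C : set T) (K Y : R -> T -> R) (s t u : R).

Lemma filtration_measurableE t : 0 <= t -> (F t).-sigma.-measurable = F t.
Proof. by move=> t0; apply: sigma_algebra_id; have [] := filtF.1 _ t0. Qed.

Lemma filtration_measurable t B : 0 <= t -> F t B -> d.-measurable B.
Proof. by move=> t0; have [_] := filtF.1 _ t0; exact. Qed.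

Lemma filtration_mono s t B : 0 <= s -> s <= t -> F s B -> F t B.
Proof. by move=> s0 st; exact: filtF.2. Qed.

Lemma filtrationI t B C : 0 <= t -> F t B -> F t C -> F t (B `&` C).
Proof. by move=> t0; rewrite -filtration_measurableE//; exact: measurableI. Qed.

Lemma filtrationU t B C : 0 <= t -> F t B -> F t C -> F t (B `|` C).
Proof. by move=> t0; rewrite -filtration_measurableE//; exact: measurableU. Qed.

Lemma filtrationD t B C : 0 <= t -> F t B -> F t C -> F t (B `\` C).
Proof. by move=> t0; rewrite -filtration_measurableE//; exact: measurableD. Qed.

Lemma filtrationT t : 0 <= t -> F t setT.
Proof. by move=> t0; rewrite -filtration_measurableE//. Qed.

Lemma filtration0 t : 0 <= t -> F t set0.
Proof. by move=> t0; rewrite -filtration_measurableE//. Qed.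

Lemma adapted_measurable_fun Y t : adapted F Y -> 0 <= t ->
  measurable_fun setT (Y t : g_sigma_algebraType (F t) -> R).
Proof.
move=> aY t0 _ B mB; rewrite setTI filtration_measurableE//; exact: aY.
Qed.

Lemma adapted_measurable Y t : adapted F Y -> 0 <= t -> measurable_fun setT (Y t).
Proof.
by move=> aY t0 _ B mB; rewrite setTI; apply: (filtration_measurable t0); exact: aY.
Qed.

Section random_time.
Variables (u : R) (theta : T -> R).
Hypotheses (u0 : 0 < u) (theta_itv : forall w, 0 <= theta w <= u).

Let J m i : set T := [set w | grid_index u m (theta w) = i].

Let theta0 w : 0 <= theta w. Proof. by have /andP[] := theta_itv w. Qed.

Let JE m i : J m i = if i is j.+1 then
  [set w | theta w <= grid_point u m i] `\` [set w | theta w <= grid_point u m j] else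
  [set w | theta w <= grid_point u m 0].
Proof.
rewrite /J; case: i => [|i]; apply/seteqP; split => w /=.
- by move=> E; rewrite -grid_index_le// E.
- by rewrite -grid_index_le// leqn0 => /eqP.
- by move=> E; rewrite -!grid_index_le// E leqnn ltnn.
- rewrite -!grid_index_le// => -[h1 /negP]; rewrite -ltnNge => h2.
  by apply/eqP; rewrite eqn_leq h1.
Qed.

Let sum_J m (k : nat -> R) w :
  k (grid_index u m (theta w)) = \sum_(i < m.+2) k i * \1_(J m i) w.
Proof.
have im : (grid_index u m (theta w) < m.+2)%N by rewrite ltnS; exact: grid_index_max.
rewrite (bigD1 (Ordinal im))//= big1 ?addr0.
  by rewrite indicE mem_set ?mulr1.
move=> i /= /negP ii; rewrite indicE memNset ?mulr0// => Ji; apply: ii.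
by apply/eqP/val_inj.
Qed.

(** A right-continuous process sampled at theta is the limit of the same process
    sampled at the finitely many values of theta rounded up to a grid. *)
Lemma measurable_at_random_time Y : measurable_fun setT theta ->
  (forall t, 0 <= t -> measurable_fun setT (Y t)) ->
  (forall w t, 0 <= t -> Y s w @[s --> t^'+] --> Y t w) ->
  measurable_fun setT (fun w => Y (theta w) w).
Proof.
move=> mtheta mY rY.
apply: (@measurable_fun_cvg _ _ _ _ (fun m w => Y (grid_ceil u m (theta w)) w)); last first.
  by move=> w _; apply: (cvg_comp_grid_ceil (f := Y ^~ w) u0) => //; exact: rY.
move=> m; under eq_fun do rewrite /grid_ceil (sum_J m (fun i => Y (grid_point u m i) _)).
apply: measurable_sum => i; apply: measurable_funM.
  by apply: mY; exact/grid_point_ge0/ltW.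
apply: measurable_indic; rewrite JE.
have mle c : measurable [set w | theta w <= c].
  have := mtheta measurableT `]-oo, c]%classic (measurable_itv _); rewrite setTI.
  by congr measurable; apply/seteqP; split => w /=; rewrite in_itv.
by case: (nat_of_ord i) => [|j] //; exact: measurableD.
Qed.

Variable K : R -> T -> R.
Hypotheses (theta_stop : forall t, 0 <= t -> F t [set w | theta w <= t]).
Hypotheses (martK : martingale P F K).
Hypotheses (rK : forall w t, 0 <= t -> K s w @[s --> t^'+] --> K t w).

Let J_F m i : F (grid_point u m i) (J m i).
Proof.
have g0 j : 0 <= grid_point u m j by exact/grid_point_ge0/ltW.
rewrite JE; case: i => [|i]; first exact: theta_stop.
apply: filtrationD => //; first exact: theta_stop.
apply: (@filtration_mono (grid_point u m i)) => //; last exact: theta_stop.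
by apply: grid_point_le => //; exact: ltW.
Qed.

Let J_measurable m i : measurable (J m i).
Proof. by apply: (filtration_measurable _ (J_F m i)); exact/grid_point_ge0/ltW. Qed.

Let integrable_indicM (D : set T) (f : T -> R) : measurable D ->
  P.-integrable setT (EFin \o f) -> P.-integrable setT (EFin \o (fun w => f w * \1_D w)).
Proof.
move=> mD iF; apply: (le_integrable measurableT _ _ iF).
  apply/measurable_EFinP; apply: measurable_funM; last exact: measurable_indic.
  by apply/measurable_EFinP; case/integrableP : iF.
move=> w _ /=; rewrite lee_fin normrM indicE; case: (_ \in _).
  by rewrite normr1 mulr1.
by rewrite normr0 mulr0.
Qed.

Let integral_J m (k : nat -> T -> R) C : measurable C ->
  (forall i : 'I_m.+2, P.-integrable setT (EFin \o k i)) ->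
  (\int[P]_(w in C) (k (grid_index u m (theta w)) w)%:E =
   \sum_(i < m.+2) \int[P]_(w in C `&` J m i) (k i w)%:E)%E.
Proof.
move=> mC ik.
under eq_integral do rewrite (sum_J m (k ^~ _)) -sumEFin.
rewrite (integral_sum mC (f := fun (i : 'I_m.+2) w => (k i w * \1_(J m i) w)%:E)).
  apply: eq_bigr => i _; rewrite integral_mkcondr; apply: eq_integral => w _.
  by rewrite patchE indicE; case: (_ \in _); rewrite ?mulr1 ?mulr0.
move=> i; apply: (integrableS measurableT mC (@subsetT _ _)).
by apply: integrable_indicM.
Qed.

Let martingale_integral s t B : 0 <= s -> s <= t -> F s B ->
  (\int[P]_(w in B) (K s w)%:E = \int[P]_(w in B) (K t w)%:E)%E.
Proof. by case: martK => _ _ H s0 st; have [_ _] := H _ _ s0 st; exact. Qed.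

(* Optional sampling at the rounded time, which takes finitely many values: on the
   event that it equals a grid point the martingale property applies. *)
Let integral_grid m C : measurable C ->
  (forall i : 'I_m.+2, F (grid_point u m i) (C `&` J m i)) ->
  \int[P]_(w in C) K (grid_ceil u m (theta w)) w = \int[P]_(w in C) K u w.
Proof.
move=> mC CJ; have [_ iK _] := martK.
have g0 j : 0 <= grid_point u m j by exact/grid_point_ge0/ltW.
rewrite /Rintegral (integral_J (m := m) (k := fun i => K (grid_point u m i)) mC).
  rewrite (integral_J (m := m) (k := fun=> K u) mC); last by move=> _; exact/iK/ltW.
  congr fine; apply: eq_bigr => i _; apply: martingale_integral => //.
  by rewrite -[leRHS](grid_pointn u m); apply: grid_point_le; [exact: ltW|rewrite -ltnS].
by move=> i; exact: iK.
Qed.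

(** The assumption on B says that B belongs to the sigma-algebra of the past of
    theta. At times rounded up to a grid this is the martingale property on each
    piece; the same identity on the events {Z > c} and {- Z > c} is the tail
    bound that permits the passage to the limit. *)
Lemma optional_sampling B :
  (forall t, 0 <= t -> F t (B `&` [set w | theta w <= t])) ->
  P.-integrable setT (EFin \o (fun w => K (theta w) w)) /\
  \int[P]_(w in B) K (theta w) w = \int[P]_(w in B) K u w.
Proof.
move=> BF; have [aK iK _] := martK.
have g0 m j : 0 <= grid_point u m j by exact/grid_point_ge0/ltW.
have BE : B = B `&` [set w | theta w <= u].
  by apply/esym/setIidPl => w _ /=; have /andP[] := theta_itv w.
have mB : measurable B.
  by rewrite BE; apply: (filtration_measurable (ltW u0)); exact/BF/ltW.
have BJ m i : F (grid_point u m i) (B `&` J m i).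
  rewrite JE; case: i => [|i]; first exact: BF.
  have -> (X Y : set T) : B `&` (X `\` Y) = (B `&` X) `\` (B `&` Y).
    by apply/seteqP; split => w /=; tauto.
  apply: filtrationD => //; first exact: BF.
  apply: (@filtration_mono (grid_point u m i)) => //; last exact: BF.
  by apply: grid_point_le => //; exact: ltW.
pose Z_ m w := K (grid_ceil u m (theta w)) w.
have iZ m : P.-integrable setT (EFin \o Z_ m).
  rewrite (_ : EFin \o _ = fun w => (\sum_(i < m.+2) (K (grid_point u m i) w * \1_(J m i) w)%:E)%E).
    apply: integrable_sum => // i _; apply: integrable_indicM => //; exact: iK.
  by apply/funext => w; rewrite sumEFin -(sum_J m (fun i => K (grid_point u m i) w)).
have mZ m : measurable_fun setT (Z_ m).
  by apply/measurable_EFinP; case/integrableP : (iZ m).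
have CF m (f : R -> R) (i : 'I_m.+2) c : measurable_fun setT f ->
    F (grid_point u m i) ([set w | c < f (Z_ m w)] `&` J m i).
  move=> mf; rewrite (_ : _ `&` _ = (K (grid_point u m i) @^-1` (f @^-1` `]c, +oo[)) `&` J m i).
    apply: filtrationI => //; apply: aK => //.
    by rewrite -[X in measurable X]setTI; exact: mf.
  apply/seteqP; split => w /= [+ Ji]; rewrite in_itv/= andbT /Z_ /grid_ceil;
    by move: (Ji); rewrite /J/= => ->.
have mC m (f : R -> R) c : measurable_fun setT f -> measurable [set w | c < f (Z_ m w)].
  move=> mf; have /(_ measurableT `]c, +oo[%classic (measurable_itv _)) :=
    measurableT_comp mf (mZ m).
  rewrite setTI; congr measurable; apply/seteqP.
  by split => w /=; rewrite in_itv/= andbT.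
have mopp : measurable_fun setT (@GRing.opp R) by exact: measurable_funN.
have iS f C : measurable C -> P.-integrable setT (EFin \o f) -> P.-integrable C (EFin \o f).
  by move=> mC' /(integrableS measurableT mC' (@subsetT _ _)).
have iKu : P.-integrable setT (EFin \o K u) by apply: iK; exact: ltW.
apply: (integral_limit_of_tail_bound (Z_ := Z_) (Y := K u)) => //.
- by move=> w; apply: (cvg_comp_grid_ceil (f := K ^~ w) u0) => //; exact: rK.
- by move=> m; apply: integral_grid => // i; exact: BJ.
- move=> m c c0.
  pose D1 := [set w | c < Z_ m w]; pose D2 := [set w | c < - Z_ m w].
  have mD1 : measurable D1 by exact: (mC m id).
  have mD2 : measurable D2 by exact: (mC m _ _ mopp).
  have DE : [set w | c < `|Z_ m w|] = D1 `|` D2.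
    by apply/seteqP; split => w; rewrite /D1 /D2 /= ltr_normr => /orP.
  have dD : [disjoint D1 & D2].
    apply/disj_set2P/seteqP; split => w //=; rewrite /D1 /D2 /= => -[].
    by move: c0; lra.
  rewrite DE !Rintegral_setU//; try by apply: iS; [exact: measurableU|exact: integrable_norm].
  have E1 : \int[P]_(w in D1) `|Z_ m w| = \int[P]_(w in D1) K u w.
    rewrite -(@integral_grid m)// => [|i]; last exact: (CF m id).
    apply: eq_Rintegral => w; rewrite inE /D1/= => cZ; rewrite ger0_norm//.
    by rewrite ltW// (le_lt_trans c0).
  have E2 : \int[P]_(w in D2) `|Z_ m w| = \int[P]_(w in D2) (- 1 * K u w).
    rewrite RintegralZl//; last exact: iS.
    rewrite -(@integral_grid m)// => [|i]; last exact: (CF m _ _ _ mopp).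
    rewrite -RintegralZl//; last exact: iS (iZ m).
    apply: eq_Rintegral => w; rewrite inE /D2/= => cZ; rewrite mulN1r ltr0_norm//.
    by rewrite -oppr_gt0 (le_lt_trans c0).
  rewrite E1 E2; apply: lerD; apply: le_Rintegral => //.
  - exact: iS.
  - by apply: iS => //; exact: integrable_norm.
  - by move=> w _; exact: ler_norm.
  - have := integrableZl mD2 (- 1) (iS _ _ mD2 iKu).
    by apply: eq_integrable => // w _; rewrite /= EFinM.
  - by apply: iS => //; exact: integrable_norm.
  - by move=> w _; rewrite mulN1r -normrN ler_norm.
Qed.

End random_time.
End filtrations.

(** * Stopping times and the variation process *)

Section stopping_times.
Context {R : realType} {d : measure_display} {T : measurableType d}.
Variables (P : probability T R) (F : R -> set (set T)).
Hypothesis filtF : filtration F.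
Implicit Types (B : set T) (K N : R -> T -> R) (r s t : R) (tau : T -> \bar R).

Definition trunc_time tau r (w : T) : R := fine (Order.min r%:E (tau w)).

Lemma trunc_timeE tau r w : (0 <= tau w)%E ->
  (trunc_time tau r w)%:E = Order.min r%:E (tau w).
Proof.
move=> tau0; rewrite /trunc_time fineK//.
by move: tau0; case: (tau w) => [x _| _ |//]; rewrite ?minEge ?leey//; case: ifPn.
Qed.

Lemma trunc_time_itv tau r w : (0 <= tau w)%E -> 0 <= r ->
  0 <= trunc_time tau r w <= r.
Proof.
move=> tau0 r0; rewrite -2!lee_fin trunc_timeE// le_min lee_fin r0 tau0/=.
by rewrite ge_min lexx.
Qed.

Lemma trunc_time_le tau r t w : (0 <= tau w)%E ->
  (trunc_time tau r w <= t) = (r <= t) || (tau w <= t%:E)%E.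
Proof. by move=> tau0; rewrite -lee_fin trunc_timeE// ge_min lee_fin. Qed.

Lemma trunc_time_id tau r w : (r%:E <= tau w)%E -> trunc_time tau r w = r.
Proof. by move=> rtau; rewrite /trunc_time (min_idPl rtau). Qed.

Lemma stopping_trunc_time tau r t : stopping_time F tau -> 0 <= r -> 0 <= t ->
  F t [set w | trunc_time tau r w <= t].
Proof.
move=> [tau0 Ftau] r0 t0; have [rt|tr] := leP r t.
  rewrite (_ : mkset _ = setT); first exact: filtrationT.
  by apply/seteqP; split => w //= _; rewrite trunc_time_le// rt.
rewrite (_ : mkset _ = [set w | (tau w <= t%:E)%E]); first exact: Ftau.
by apply/seteqP; split => w /=; rewrite trunc_time_le// (leNgt r) tr.
Qed.

Lemma measurable_trunc_time tau r : stopping_time F tau -> 0 <= r ->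
  measurable_fun setT (trunc_time tau r).
Proof.
move=> st r0; apply: (measurability _ (RGenOInfty.measurableE R)).
move=> _ [_ [c ->] <-]; rewrite setTI.
rewrite (_ : _ @^-1` _ = ~` [set w | trunc_time tau r w <= c]); last first.
  apply/seteqP; split => w /=; rewrite in_itv/= andbT.
    by rewrite ltNge => /negP.
  by move=> /negP; rewrite -ltNge.
apply: measurableC; have [c0|c0] := ltP c 0.
  rewrite (_ : mkset _ = set0)//; apply/seteqP; split => w //=.
  have /andP[t0 _] := trunc_time_itv (st.1 w) r0.
  by rewrite leNgt (lt_le_trans c0).
by apply: (filtration_measurable filtF c0); exact: stopping_trunc_time.
Qed.

Lemma stopping_time_min tau tau' : stopping_time F tau -> stopping_time F tau' ->
  stopping_time F (fun w => Order.min (tau w) (tau' w)).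
Proof.
move=> [t0 st] [t0' st']; split => [w|t tge0]; first by rewrite le_min t0 t0'.
rewrite (_ : mkset _ = [set w | (tau w <= t%:E)%E] `|` [set w | (tau' w <= t%:E)%E]).
  by apply: filtrationU => //; [exact: st|exact: st'].
by apply/seteqP; split => w /=; rewrite ge_min => /orP.
Qed.

(** A stopped martingale has the martingale property. On {tau <= s} both sides
    sample the same time; on {tau > s} the times are s and r /\ tau; the martingale
    property and optional sampling send both integrals to that of K r. *)
Lemma optional_stopping K tau s r B : martingale P F K ->
  (forall w t, 0 <= t -> K x w @[x --> t^'+] --> K t w) ->
  stopping_time F tau -> 0 <= s -> s <= r -> F s B ->
  P.-integrable setT (EFin \o (fun w => K (trunc_time tau r w) w)) /\
  \int[P]_(w in B) K (trunc_time tau r w) w = \int[P]_(w in B) K (trunc_time tau s w) w.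
Proof.
move=> mK rK st s0 sr BF; have [tau0 Ftau] := st.
have [aK iK HK] := mK.
have mKt t : 0 <= t -> measurable_fun setT (fun w => K (trunc_time tau t w) w).
  move=> t0; have [t0'|t0'] := ltP 0 t.
    apply: (measurable_at_random_time t0') => //.
    - by move=> w; exact: trunc_time_itv.
    - exact: measurable_trunc_time.
    - by move=> x x0; exact: (adapted_measurable filtF).
  have -> : t = 0 by apply/eqP; rewrite eq_le t0 t0'.
  rewrite (_ : (fun _ => _) = K 0); first exact: (adapted_measurable filtF).
  by apply/funext => w; rewrite trunc_time_id.
have iKt t : 0 <= t ->
    P.-integrable setT (EFin \o (fun w => K (trunc_time tau t w) w)).
  move=> t0; have [t0'|t0'] := ltP 0 t; last first.
    have -> : t = 0 by apply/eqP; rewrite eq_le t0 t0'.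
    rewrite (_ : _ \o _ = EFin \o K 0); first exact: iK.
    by apply/funext => w /=; rewrite trunc_time_id.
  have [|//] := optional_sampling filtF t0' (fun w => trunc_time_itv (tau0 w) t0)
     (fun x => stopping_trunc_time st t0) mK rK (B := setT).
  by move=> x x0; rewrite setTI; exact: stopping_trunc_time.
have r0 := le_trans s0 sr.
split; first exact: iKt.
have [->//|rs] := eqVneq r s.
have sr' : s < r by rewrite lt_neqAle eq_sym rs.
have r0' : 0 < r by exact: le_lt_trans sr'.
pose C := [set w | (tau w <= s%:E)%E].
have CF : F s C by exact: Ftau.
have BC : F s (B `\` C) by exact: filtrationD.
have mB := filtration_measurable filtF s0 BF.
have mC := filtration_measurable filtF s0 CF.
have iS f D : measurable D -> P.-integrable setT (EFin \o f) -> P.-integrable D (EFin \o f).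
  by move=> mD /(integrableS measurableT mD (@subsetT _ _)).
have BE : B = (B `\` C) `|` (B `&` C) by rewrite setUC setUIDK.
have dBC : [disjoint (B `\` C) & (B `&` C)].
  by apply/disj_set2P/seteqP; split => w //= -[[_ nC] [_ /nC]].
rewrite BE !Rintegral_setU//; do ?[by apply: iS; rewrite -?BE//; exact: iKt];
  do ?[exact: measurableD|exact: measurableI].
congr (_ + _); last first.
  apply: eq_Rintegral => w; rewrite inE => -[_ Cw]; congr (K _ w).
  apply: EFin_inj; rewrite !trunc_timeE// (min_idPr Cw) (min_idPr _)//.
  by rewrite (le_trans Cw)// lee_fin.
have [|_ ->] := optional_sampling filtF r0' (fun w => trunc_time_itv (tau0 w) r0)
   (fun x => stopping_trunc_time st r0) mK rK (B := B `\` C).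
  move=> t t0; have [st'|ts] := leP s t.
    apply: filtrationI => //; last exact: stopping_trunc_time.
    exact: filtration_mono BC.
  rewrite (_ : _ `&` _ = set0); first exact: filtration0.
  apply/seteqP; split => w //= -[[_ Cw]]; rewrite trunc_time_le// => /orP[rt|tt].
    by move: (lt_trans (le_lt_trans rt ts) sr'); rewrite ltxx.
  by apply: Cw; rewrite /C/= (le_trans tt)// lee_fin ltW.
transitivity (\int[P]_(w in B `\` C) K s w).
  by have [_ _ H] := HK _ _ s0 sr; rewrite /Rintegral H.
apply: eq_Rintegral => w; rewrite inE => -[_ /negP]; rewrite -ltNge => /ltW Cw.
by rewrite trunc_time_id.
Qed.

End stopping_times.

Section variation_stopping.
Context {R : realType} {d : measure_display} {T : measurableType d}.
Variables (F : R -> set (set T)).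
Hypothesis filtF : filtration F.
Variable N : R -> T -> R.
Hypotheses (aN : adapted F N) (cN : cadlag N) (fN : finite_variation N).
Implicit Types (s t : R) (k : nat).

Definition variation_process t w : R := fine (total_variation 0 t (N ^~ w)).

Lemma variation_process_fin w t : 0 <= t -> total_variation 0 t (N ^~ w) \is a fin_num.
Proof. by move=> t0; apply/bounded_variationP => //; exact: fN. Qed.

Lemma variation_process_adapted : adapted F variation_process.
Proof.
move=> t t0 B mB.
suff H : measurable_fun setT (variation_process t : g_sigma_algebraType (F t) -> R).
  by have := H measurableT _ mB; rewrite setTI (filtration_measurableE filtF).
have [t0'|t0'] := ltP 0 t; last first.
  rewrite (_ : variation_process t = cst 0); first exact: measurable_cst.
  apply/funext => w; have -> : t = 0 by apply/eqP; rewrite eq_le t0 t0'.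
  by rewrite /variation_process total_variationxx.
apply: (@measurableT_comp _ _ _ _ _ _ fine); first exact: fine_measurable.
have -> : (fun w => total_variation 0 t (N ^~ w)) =
    (fun w => esups (fun m => (grid_variation t m (N ^~ w))%:E) 0).
  apply/funext => w; rewrite total_variation_grid//; last first.
    by move=> x /andP[x0 _]; exact: (cN w).1.
  congr ereal_sup; apply/seteqP; split => [_ [m _ <-]|_ [m _ <-]]; exists m => //.
apply: (@measurable_fun_esups _ (g_sigma_algebraType (F t))) => m.
have mg j : (j <= m.+1)%N -> measurable_fun setT (N (grid_point t m j) : g_sigma_algebraType (F t) -> R).
  move=> jm _ B' mB'; rewrite setTI (filtration_measurableE filtF)//.
  apply: (@filtration_mono _ _ _ F filtF (grid_point t m j)) => //; first exact: grid_point_ge0.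
    by rewrite -[leRHS](grid_pointn t m); exact: grid_point_le.
  by apply: aN => //; exact: grid_point_ge0.
apply/measurable_EFinP; rewrite /grid_variation.
under eq_fun do rewrite big_mkord.
apply: (@measurable_sum _ (g_sigma_algebraType (F t))) => i.
apply: (measurableT_comp (f := @Num.norm R R)) => //.
apply: (@measurable_funB _ (g_sigma_algebraType (F t))); apply: mg => //.
exact: ltnW.
Qed.

Lemma variation_process_nondecreasing w s t : 0 <= s -> s <= t ->
  variation_process s w <= variation_process t w.
Proof.
move=> s0 st; have t0 := le_trans s0 st.
apply: fine_le; do ?exact: variation_process_fin.
by apply: (@total_variation_nondecreasing _ 0 t); rewrite ?in_itv/= ?s0 ?t0 ?lexx.
Qed.

Lemma variation_process_right_continuous w t : 0 <= t ->
  variation_process s w @[s --> t^'+] --> variation_process t w.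
Proof.
move=> t0; have t1 : t < t + 1 by rewrite ltrDl.
apply: (total_variation_right_continuous t0 t1); first exact: (cN w).1.
by apply: fN; rewrite (le_trans t0)// ltW.
Qed.

(** The first time when the variation reaches k: by right continuity it is at most
    t if and only if the variation at t is at least k, so that it is a
    stopping time. *)
Definition variation_hitting k (w : T) : \bar R :=
  ereal_inf [set s%:E | s in [set s | 0 <= s /\ k%:R <= variation_process s w]].

Lemma variation_hitting_le k w t : 0 <= t ->
  (variation_hitting k w <= t%:E)%E = (k%:R <= variation_process t w).
Proof.
move=> t0; apply/idP/idP => [ht|kt]; last by apply: ereal_inf_lbound; exists t.
have rW := variation_process_right_continuous (w := w) t0.
apply: (ler_cvg_to (cvg_cst _) rW).
near=> s; have ts : t < s by near: s; exact: nbhs_right_gt.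
have : (variation_hitting k w < s%:E)%E by rewrite (le_lt_trans ht)// lte_fin.
move=> /ereal_inf_lt[_ [x [x0 kx] <-]]; rewrite lte_fin => /ltW xs.
by apply: (le_trans kx); exact: variation_process_nondecreasing.
Unshelve. all: by end_near. Qed.

Lemma variation_hitting_stopping k : stopping_time F (variation_hitting k).
Proof.
split => [w|t t0]; first by apply: le_ereal_inf_tmp => _ [s [s0 _] <-]; rewrite lee_fin.
rewrite (_ : mkset _ = variation_process t @^-1` `[k%:R, +oo[).
  by apply: variation_process_adapted.
by apply/seteqP; split => w /=; rewrite in_itv/= andbT variation_hitting_le.
Qed.

Lemma variation_process_before_hitting k w s : 0 <= s ->
  (s%:E < variation_hitting k w)%E -> variation_process s w < k%:R.
Proof. by move=> s0; rewrite ltNge variation_hitting_le// -ltNge. Qed.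

End variation_stopping.

(** * Random measures on predictable sets *)

Section predictable_sets.
Context {R : realType} {d : measure_display} {T : measurableType d}.
Variables (P : probability T R) (F : R -> set (set T)).
Hypothesis filtF : filtration F.
Implicit Types (E : set (R * T)).

Let D : set (R * T) := [set p | 0 <= p.1].

Lemma predictable_rectangles_setI : setI_closed (predictable_rectangles F).
Proof.
move=> E E' [[B B0 ->]|[s [t [B [s0 st Bs ->]]]]] [[B' B0' ->]|[s' [t' [B' [s0' st' Bs' ->]]]]].
- left; exists (B `&` B'); first exact: filtrationI.
  by apply/seteqP; split => -[x w] /=; tauto.
- left; exists set0; first exact: filtration0.
  apply/seteqP; split => -[x w]; last by case.
  rewrite /= in_itv/= => -[[-> _] [/andP[h _] _]].
  by move: h; rewrite ltNge s0'.
- left; exists set0; first exact: filtration0.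
  apply/seteqP; split => -[x w]; last by case.
  rewrite /= in_itv/= => -[[/andP[h _] _] [xE _]].
  by move: h; rewrite xE ltNge s0.
- right; pose m := Num.max s s'.
  have sm : s <= m by rewrite le_max lexx.
  have sm' : s' <= m by rewrite le_max lexx orbT.
  exists m, (Num.max m (Num.min t t')), (B `&` B'); split.
  + exact: le_trans sm.
  + by rewrite le_max lexx.
  + have m0 : 0 <= m := le_trans s0 sm.
    apply: (filtrationI filtF m0).
      by apply: (filtration_mono filtF s0 sm).
    by apply: (filtration_mono filtF s0' sm').
  + apply/seteqP; split => -[x w] /=; rewrite !in_itv/=.
      move=> [[/andP[sx xt] Bw] [/andP[sx' xt'] Bw']]; split => //.
      by rewrite gt_max sx sx' le_max le_min xt xt' orbT.
    rewrite gt_max le_max le_min => -[/andP[/andP[sx sx']]].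
    have mx : x <= m = false by apply/negbTE; rewrite -ltNge gt_max sx.
    by rewrite mx/= => /andP[xt xt'] [Bw Bw']; rewrite sx sx' xt xt'.
Qed.

Lemma predictable_sigma_algebra_sub E : predictable_sigma_algebra F E -> E `<=` D.
Proof.
move=> sE; apply: (sE [set X | X `<=` D]); split => [|A].
- split => [//|A AD p []//|A AD]; by apply: bigcup_sub => n _; exact: AD.
- case=> [[B _ ->]|[s [t [B [s0 _ _ ->]]]]] -[x w] /=; first by rewrite /D/= => -[-> _].
  by rewrite in_itv/= => -[/andP[sx _] _]; rewrite /D/= (le_trans s0)// ltW.
Qed.

Definition path_section E w : set (measurableTypeR R) := [set s | E (s, w)].
Local Notation section := path_section.

(** Measurability is part of the notion because the class of such sets has to be
    stable under the operations of a lambda-system. *)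
Definition agree_in_mean (nu nu' : T -> {measure set (measurableTypeR R) -> \bar R}) E :=
  [/\ forall w, measurable (section E w),
     measurable_fun setT (fun w => nu w (section E w)),
     measurable_fun setT (fun w => nu' w (section E w)) &
     (\int[P]_w nu w (section E w) = \int[P]_w nu' w (section E w))%E].

(** Predictable rectangles are stable under intersection, and sets on which two
    random measures of finite mean mass agree in mean form a lambda-system, so
    the pi-lambda theorem applies. This is how predictability enters. *)
Lemma predictable_agree_in_mean (nu nu' : T -> {measure set (measurableTypeR R) -> \bar R}) :
  (forall w, nu w (section D w) < +oo)%E -> (forall w, nu' w (section D w) < +oo)%E ->
  (\int[P]_w nu w (section D w) < +oo)%E ->
  agree_in_mean nu nu' D ->
  predictable_rectangles F `<=` agree_in_mean nu nu' ->
  predictable_sigma_algebra F `<=` agree_in_mean nu nu'.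
Proof.
move=> nuoo nuoo' intoo aD arect.
have intoo' : (\int[P]_w nu' w (section D w) < +oo)%E by case: aD => _ _ _ <-.
pose H E := E `<=` D /\ agree_in_mean nu nu' E.
have mD w : measurable (section D w) by case: aD.
suff : predictable_sigma_algebra F `<=` H by move=> HP E /HP[].
apply: lambda_system_subset; last 2 first.
- by move=> E EG; split; [apply: predictable_sigma_algebra_sub; exact: sub_sigma_algebra|exact: arect].
- exact: predictable_sigma_algebra_sub.
- exact: predictable_rectangles_setI.
have fin (mu : T -> {measure set (measurableTypeR R) -> \bar R}) E w :
    (mu w (section D w) < +oo)%E -> E `<=` D ->
    measurable (section E w) -> (mu w (section E w) < +oo)%E.
  move=> oo ED mE; apply: le_lt_trans oo; apply: le_measure; rewrite ?inE//.
  by move=> x; exact: ED.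
have int (mu : T -> {measure set (measurableTypeR R) -> \bar R}) E :
    (\int[P]_w mu w (section D w) < +oo)%E -> E `<=` D ->
    (forall w, measurable (section E w)) ->
    measurable_fun setT (fun w => mu w (section D w)) ->
    measurable_fun setT (fun w => mu w (section E w)) ->
    P.-integrable setT (fun w => mu w (section E w)).
  move=> oo ED mE mD' mf; apply/integrableP; split => //.
  under eq_integral do rewrite gee0_abs//.
  apply: le_lt_trans oo; apply: ge0_le_integral => // w _; apply: le_measure; rewrite ?inE//.
  by move=> x; exact: ED.
split => [E []//||A B BA [AD [mA mA1 mA2 intA]] [BD [mB mB1 mB2 intB]]|A ndA HA].
- by split.
- split; first by apply: subset_trans AD; exact: subDsetl.
  have secAB w : section (A `\` B) w = section A w `\` section B w by [].
  have BA' w : section A w `&` section B w = section B w.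
    by apply/setIidr => x; exact: BA.
  have muD (mu : T -> {measure set (measurableTypeR R) -> \bar R}) :
     (forall w, mu w (section D w) < +oo)%E ->
     (fun w => mu w (section (A `\` B) w)) = (fun w => mu w (section A w) - mu w (section B w))%E.
    move=> oo; apply/funext => w; rewrite secAB measureD//; last exact: fin.
    by rewrite BA'.
  case: aD => _ mD1 mD2 _.
  split.
  + by move=> w; rewrite secAB; exact: measurableD.
  + by rewrite muD//; exact: emeasurable_funB.
  + by rewrite muD//; exact: emeasurable_funB.
  + rewrite (eq_integral _ _ (fun w _ => congr1 (@^~ w) (muD nu nuoo))).
    rewrite [RHS](eq_integral _ _ (fun w _ => congr1 (@^~ w) (muD nu' nuoo'))).
    rewrite !integralB//; try exact: int.
    by rewrite intA intB.
- split; first by apply: bigcup_sub => n _; exact: (HA n).1.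
  have secA w : section (\bigcup_n A n) w = \bigcup_n section (A n) w by [].
  have mA n w : measurable (section (A n) w) by have [_ []] := HA n.
  have mU w : measurable (section (\bigcup_n A n) w).
    by rewrite secA; exact: bigcup_measurable.
  have nd w : {homo (fun n => section (A n) w) : n m / (n <= m)%N >-> (n <= m)%O}.
    by move=> n m /ndA/subsetPset nm; apply/subsetPset => x; exact: nm.
  have cvgA (mu : T -> {measure set (measurableTypeR R) -> \bar R}) w :
      mu w (section (A n) w) @[n --> \oo] --> mu w (section (\bigcup_n A n) w).
    rewrite secA; apply: (nondecreasing_cvg_mu (mu := mu w)) => //.
    by rewrite -secA.
  have mc (mu : T -> {measure set (measurableTypeR R) -> \bar R}) :
      (forall n, measurable_fun setT (fun w => mu w (section (A n) w))) ->
      (\int[P]_w mu w (section (\bigcup_n A n) w) =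
       limn (fun n => \int[P]_w mu w (section (A n) w)))%E.
    move=> mf; rewrite -monotone_convergence//.
    - by apply: eq_integral => w _; apply/esym/cvg_lim => //; exact: cvgA.
    - move=> w _ n m nm; apply: le_measure; rewrite ?inE//.
      by apply/subsetPset; exact: nd.
  have m1 n : measurable_fun setT (fun w => nu w (section (A n) w)) by have [_ []] := HA n.
  have m2 n : measurable_fun setT (fun w => nu' w (section (A n) w)) by have [_ []] := HA n.
  split => //.
  + by apply: (emeasurable_fun_cvg _ _ m1) => w _; exact: cvgA.
  + by apply: (emeasurable_fun_cvg _ _ m2) => w _; exact: cvgA.
  + rewrite !mc//; congr (limn _); apply/funext => n.
    by have [_ []] := HA n.
Qed.

End predictable_sets.

(** * Localizing the difference of two decompositions *)

Section path_operations.
Context {R : realType}.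
Implicit Types (a b : R -> R).

Lemma finite_variation_pathD a b : finite_variation_path a -> finite_variation_path b ->
  finite_variation_path (fun s => a s + b s).
Proof.
move=> fa fb t; rewrite le_eqVlt => /predU1P[<-|t0]; first exact: bounded_variationxx.
by apply: (bounded_variationD t0); [apply: fa|apply: fb]; exact: ltW.
Qed.

Lemma finite_variation_pathB a b : finite_variation_path a -> finite_variation_path b ->
  finite_variation_path (fun s => a s - b s).
Proof. by move=> fa fb; apply: finite_variation_pathD => //; exact: finite_variation_pathN. Qed.

Lemma cadlag_pathD a b : cadlag_path a -> cadlag_path b -> cadlag_path (fun s => a s + b s).
Proof.
move=> [ra la] [rb lb]; split => t t0; first by apply: cvgD; [exact: ra|exact: rb].
by apply: is_cvgD; [exact: la|exact: lb].
Qed.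

Lemma cadlag_pathB a b : cadlag_path a -> cadlag_path b -> cadlag_path (fun s => a s - b s).
Proof. by move=> ca cb; apply: cadlag_pathD => //; exact: cadlag_pathN. Qed.

End path_operations.

Section stopped_paths.
Context {R : realType} {d : measure_display} {T : measurableType d}.

Lemma stopped_right_continuous (X : R -> T -> R) (tau : T -> \bar R) w t :
  (0 <= tau w)%E -> 0 <= t ->
  (forall s, 0 <= s -> X x w @[x --> s^'+] --> X s w) ->
  stopped X tau x w @[x --> t^'+] --> stopped X tau t w.
Proof.
move=> tau0 t0 rX; have [tt|tt] := leP (tau w) t%:E.
  apply: cvg_near_cst; near=> s; congr (X _ w); congr fine.
  have ts : t <= s by near: s; exact: nbhs_right_ge.
  by rewrite (min_idPr tt) (min_idPr _)// (le_trans tt).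
rewrite /stopped (min_idPl (ltW tt))/=.
have st : \forall s \near t^'+, (s%:E <= tau w)%E.
  move: tt; case: (tau w) => [x|_|//]; last by apply: nearW => s; rewrite leey.
  by rewrite lte_fin => /nbhs_right_le; apply: filterS => s; rewrite lee_fin.
apply: cvg_trans (rX _ t0); apply: near_eq_cvg; apply: filterS st => s st.
by rewrite (min_idPl st).
Unshelve. all: by end_near. Qed.

End stopped_paths.

Section ae_integral.
Context {R : realType} {d : measure_display} {T : measurableType d}.
Variable P : probability T R.
Implicit Types (f g : T -> R).

Lemma ae_eq_integrable f g : measurable_fun setT f -> P.-integrable setT (EFin \o g) ->
  {ae P, forall w, f w = g w} -> P.-integrable setT (EFin \o f).
Proof.
move=> mf ig fg; have mg : measurable_fun setT g.
  by apply/measurable_EFinP; case/integrableP : ig.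
apply/integrableP; split; first exact/measurable_EFinP.
have /integrableP[_] := ig; rewrite (@ae_eq_integral _ _ _ P setT (fun w => `|(EFin \o g) w|%E)
  (fun w => `|(EFin \o f) w|%E))//.
- by apply: measurableT_comp => //; exact/measurable_EFinP.
- by apply: measurableT_comp => //; exact/measurable_EFinP.
- by apply: filterS fg => w /= -> _.
Qed.

Lemma ae_eq_Rintegral f g B : measurable_fun setT f -> measurable_fun setT g -> measurable B ->
  {ae P, forall w, f w = g w} -> \int[P]_(w in B) f w = \int[P]_(w in B) g w.
Proof.
move=> mf mg mB fg; congr fine; apply: ae_eq_integral => //.
- by apply/measurable_EFinP; exact: measurable_funTS.
- by apply/measurable_EFinP; exact: measurable_funTS.
- by apply: filterS fg => w /= -> _.
Qed.

End ae_integral.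

Section decomposition_difference.
Context {R : realType} {d : measure_display} {T : measurableType d}.
Variables (P : probability T R) (F : R -> set (set T)).
Hypothesis filtF : filtration F.
Implicit Types (r s t u : R) (B : set T) (w : T).

Section localized.
Variables (M M' N : R -> T -> R) (tau tau' : T -> \bar R) (n : nat).
Hypotheses (cM : cadlag M) (cM' : cadlag M').
Hypotheses (st : stopping_time F tau) (st' : stopping_time F tau').
Hypotheses (mM : martingale P F (fun t w => stopped M tau t w - M 0 w)).
Hypotheses (mM' : martingale P F (fun t w => stopped M' tau' t w - M' 0 w)).
Hypotheses (aN : adapted F N) (cN : cadlag N) (fN : finite_variation N).
Hypotheses (NE : {ae P, forall w, forall t, 0 <= t -> N t w = (M' t w - M' 0 w) - (M t w - M 0 w)}).

(* The three times make M stopped at tau and M' stopped at tau' martingales, and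
   bound the variation of N strictly before rho. *)
Let rho w : \bar R := Order.min (tau w) (Order.min (tau' w) (variation_hitting N n w)).

Let sst : stopping_time F (variation_hitting N n).
Proof. exact: variation_hitting_stopping. Qed.

Lemma localizing_stopping : stopping_time F rho.
Proof. by apply: stopping_time_min => //; exact: stopping_time_min. Qed.

Let rho0 w : (0 <= rho w)%E. Proof. exact: localizing_stopping.1. Qed.

Let rho_itv w r : 0 <= r -> 0 <= trunc_time rho r w <= r.
Proof. by move=> r0; exact: trunc_time_itv. Qed.

Lemma measurable_at_localizing (Y : R -> T -> R) r : 0 <= r ->
  (forall t, 0 <= t -> measurable_fun setT (Y t)) ->
  (forall w t, 0 <= t -> Y s w @[s --> t^'+] --> Y t w) ->
  measurable_fun setT (fun w => Y (trunc_time rho r w) w).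
Proof.
move=> r0 mY rY; have [r0'|r0'] := ltP 0 r.
  apply: (measurable_at_random_time r0') => //; first by move=> w; exact: rho_itv.
  exact: (measurable_trunc_time filtF localizing_stopping).
have -> : r = 0 by apply/eqP; rewrite eq_le r0 r0'.
rewrite (_ : (fun _ => _) = Y 0); first exact: mY.
by apply/funext => w; rewrite trunc_time_id.
Qed.

(** Stopping M at tau and then at the minimum of tau' and the hitting time is
    stopping at rho, and likewise for M'; the stopped difference therefore inherits
    the martingale property from both. *)
Lemma difference_localized s r B : 0 <= s -> s <= r -> F s B ->
  P.-integrable setT (EFin \o (fun w => N (trunc_time rho r w) w)) /\
  \int[P]_(w in B) N (trunc_time rho r w) w = \int[P]_(w in B) N (trunc_time rho s w) w.
Proof.
move=> s0 sr BF; have r0 := le_trans s0 sr.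
have mB : measurable B by exact: (filtration_measurable filtF s0).
have rK (X : R -> T -> R) ta : cadlag X -> stopping_time F ta ->
    forall w t, 0 <= t -> (stopped X ta x w - X 0 w) @[x --> t^'+] --> stopped X ta t w - X 0 w.
  move=> cX sta w t t0; apply: cvgB; last exact: cvg_cst.
  by apply: stopped_right_continuous => //; [exact: sta.1|exact: (cX w).1].
have k0 := stopping_time_min filtF st' sst.
have k0' := stopping_time_min filtF st sst.
have H := optional_stopping filtF mM (rK _ _ cM st) k0.
have H' := optional_stopping filtF mM' (rK _ _ cM' st') k0'.
have KE t : 0 <= t ->
    (fun w => stopped M tau (trunc_time (fun w => Order.min (tau' w) (variation_hitting N n w)) t w) w - M 0 w)
    = (fun w => M (trunc_time rho t w) w - M 0 w).
  move=> t0; apply/funext => w; congr (M _ w - _).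
  rewrite -/(trunc_time _ _ _); apply: EFin_inj; rewrite !trunc_timeE//; last 2 first.
  - exact: k0.1.
  - exact: st.1.
  by rewrite /rho -minA; congr Order.min; rewrite minC.
have KE' t : 0 <= t ->
    (fun w => stopped M' tau' (trunc_time (fun w => Order.min (tau w) (variation_hitting N n w)) t w) w - M' 0 w)
    = (fun w => M' (trunc_time rho t w) w - M' 0 w).
  move=> t0; apply/funext => w; congr (M' _ w - _).
  rewrite -/(trunc_time _ _ _); apply: EFin_inj; rewrite !trunc_timeE//; last 2 first.
  - exact: k0'.1.
  - exact: st'.1.
  by rewrite /rho -minA; congr Order.min; rewrite -minA; congr Order.min; rewrite minC.
pose g t w := (M' (trunc_time rho t w) w - M' 0 w) - (M (trunc_time rho t w) w - M 0 w).
have iM t : 0 <= t -> P.-integrable setT (EFin \o (fun w => M (trunc_time rho t w) w - M 0 w)).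
  move=> t0; have [+ _] := H _ _ _ t0 (lexx t) (filtrationT filtF t0).
  by rewrite KE.
have iM' t : 0 <= t -> P.-integrable setT (EFin \o (fun w => M' (trunc_time rho t w) w - M' 0 w)).
  move=> t0; have [+ _] := H' _ _ _ t0 (lexx t) (filtrationT filtF t0).
  by rewrite KE'.
have ig t : 0 <= t -> P.-integrable setT (EFin \o g t).
  by move=> t0; have := integrableB measurableT (iM' _ t0) (iM _ t0).
have mN t : 0 <= t -> measurable_fun setT (fun w => N (trunc_time rho t w) w).
  move=> t0; apply: measurable_at_localizing => //.
    by move=> x x0; exact: (adapted_measurable filtF).
  by move=> w x x0; exact: (cN w).1.
have Ng t : 0 <= t -> {ae P, forall w, N (trunc_time rho t w) w = g t w}.
  move=> t0; apply: filterS NE => w; apply.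
  by have /andP[] := rho_itv w t0.
have mg t : 0 <= t -> measurable_fun setT (g t).
  by move=> t0; apply/measurable_EFinP; case/integrableP : (ig t t0).
have iS f : P.-integrable setT (EFin \o f) -> P.-integrable B (EFin \o f).
  by move=> /(integrableS measurableT mB (@subsetT _ _)).
split; first exact: ae_eq_integrable (mN _ r0) (ig _ r0) (Ng _ r0).
rewrite (ae_eq_Rintegral (mN _ r0) (mg _ r0) mB (Ng _ r0)).
rewrite (ae_eq_Rintegral (mN _ s0) (mg _ s0) mB (Ng _ s0)).
have gB t : 0 <= t -> \int[P]_(w in B) g t w =
    \int[P]_(w in B) (M' (trunc_time rho t w) w - M' 0 w) -
    \int[P]_(w in B) (M (trunc_time rho t w) w - M 0 w).
  by move=> t0; rewrite -RintegralB//; apply: iS; [exact: iM'|exact: iM].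
have HM : \int[P]_(w in B) (M (trunc_time rho r w) w - M 0 w) =
    \int[P]_(w in B) (M (trunc_time rho s w) w - M 0 w).
  by rewrite -(KE _ r0) -(KE _ s0); exact: (H _ _ _ s0 sr BF).2.
have HM' : \int[P]_(w in B) (M' (trunc_time rho r w) w - M' 0 w) =
    \int[P]_(w in B) (M' (trunc_time rho s w) w - M' 0 w).
  by rewrite -(KE' _ r0) -(KE' _ s0); exact: (H' _ _ _ s0 sr BF).2.
by rewrite (gB _ r0) (gB _ s0) HM HM'.
Qed.

(** The hitting time bounds the variation before rho but not the jump at rho,
    which is bounded by the value of the stopped martingale, hence integrable. *)
Lemma localized_variation_le r w : 0 <= r ->
  variation_process N (trunc_time rho r w) w <=
    n%:R + n%:R + `|N 0 w| + `|N (trunc_time rho r w) w|.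
Proof.
move=> r0; have /andP[t0 _] := rho_itv w r0.
have [t0'|t0'] := ltP 0 (trunc_time rho r w); last first.
  have -> : trunc_time rho r w = 0 by apply/eqP; rewrite eq_le t0 t0'.
  by rewrite /variation_process total_variationxx/= !addr_ge0.
apply: total_variation_jump_le => // s /andP[s0 st0].
apply/ltW/(@variation_process_before_hitting _ _ _ N cN fN n w) => //.
rewrite -lte_fin trunc_timeE// in st0; apply: (lt_le_trans st0).
by rewrite /rho !ge_min lexx !orbT.
Qed.

End localized.
End decomposition_difference.

(** * Predictable martingales of integrable variation *)

(** Integrating the pointwise inequality leaves no room for the positive part of g. *)
Lemma ae_le0_of_integral_eq {R : realType} {d : measure_display} {T : measurableType d}
    (P : probability T R) (g : T -> R) (h h' : T -> \bar R) :
  measurable_fun setT g -> measurable_fun setT h -> measurable_fun setT h' ->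
  (forall w, 0 <= h w)%E -> (forall w, 0 <= h' w)%E ->
  (\int[P]_w h w = \int[P]_w h' w)%E -> (\int[P]_w h' w < +oo)%E ->
  {ae P, forall w, (Num.max 0 (g w))%:E + h w <= h' w}%E ->
  {ae P, forall w, g w <= 0}.
Proof.
move=> mg mh mh' h0 h'0 hh' foo gh.
have gmax0 w : (0 <= (Num.max 0 (g w))%:E)%E by rewrite lee_fin le_max lexx.
have mmax : measurable_fun setT (fun w => (Num.max 0 (g w))%:E).
  by apply/measurable_EFinP; exact: measurable_maxr.
have int0 : (\int[P]_w (Num.max 0 (g w))%:E = 0)%E.
  apply/eqP; rewrite eq_le integral_ge0 ?andbT//.
  have : (\int[P]_w ((Num.max 0 (g w))%:E + h w) <= \int[P]_w h' w)%E.
    apply: ae_ge0_le_integral => //.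
    - by move=> w _; exact: adde_ge0.
    - exact: emeasurable_funD.
    - by apply: filterS gh => w + _.
  rewrite ge0_integralD// hh' -[X in (_ <= X)%E -> _]add0e leeD2rE//.
  by rewrite ge0_fin_numE// integral_ge0.
have := (ae_eq_integral_abs P measurableT mmax).1.
under eq_integral do rewrite gee0_abs//.
move=> /(_ int0); apply: filterS => w /(_ Logic.I) [] gw0.
by rewrite -[X in _ <= X]gw0 le_max lexx orbT.
Qed.

Section stieltjes_on.
Context {R : realType}.
Implicit Types (f : R -> R) (v : R).

(* An opaque proof provides the measure, so that unification does not unfold the
   construction of Lebesgue-Stieltjes measures. *)
Lemma stieltjes_on_subproof f v : {mu : {measure set (measurableTypeR R) -> \bar R} |
  forall A, mu A = stieltjes_measure f (A `&` `]0, v])}.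
Proof.
have m0v : measurable (`]0, v]%classic : set (measurableTypeR R)) by exact: measurable_itv.
by exists (mrestr (stieltjes_measure f) m0v).
Qed.

Definition stieltjes_on f v := sval (stieltjes_on_subproof f v).

Lemma stieltjes_onE f v A :
  stieltjes_on f v A = stieltjes_measure f (A `&` `]0, v]).
Proof. by rewrite /stieltjes_on; case: stieltjes_on_subproof. Qed.

End stieltjes_on.

Section stopped_predictable_martingale.
Context {R : realType} {d : measure_display} {T : measurableType d}.
Variables (P : probability T R) (F : R -> set (set T)).
Hypothesis filtF : filtration F.
Implicit Types (r s t u : R) (B : set T) (w : T).
(* N stopped at rho is a martingale of integrable variation on [0, t]. *)
Variables (N : R -> T -> R) (rho : T -> \bar R) (k t : R).
Hypotheses (aN : adapted F N) (cN : cadlag N) (fN : finite_variation N).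
Hypothesis (st : stopping_time F rho).
Hypothesis t0 : 0 < t.
Hypothesis iN : forall r, 0 <= r -> P.-integrable setT (EFin \o (fun w => N (trunc_time rho r w) w)).
Hypothesis NB : forall s r B, 0 <= s -> s <= r -> F s B ->
  \int[P]_(w in B) N (trunc_time rho r w) w = \int[P]_(w in B) N (trunc_time rho s w) w.
Hypothesis varN : forall w, variation_process N (trunc_time rho t w) w <=
  k + `|N 0 w| + `|N (trunc_time rho t w) w|.

Let rho_t w := trunc_time rho t w.

Let rho_t0 w : 0 <= rho_t w.
Proof. by have /andP[] := trunc_time_itv (st.1 w) (ltW t0). Qed.

Let p s w := pos_part_path (N ^~ w) s.
Let n s w := neg_part_path (N ^~ w) s.

Let ndp w : nondecreasing (p ^~ w). Proof. exact: pos_part_path_nondecreasing. Qed.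
Let ndn w : nondecreasing (n ^~ w). Proof. exact: neg_part_path_nondecreasing. Qed.
Let rp w : right_continuous (p ^~ w). Proof. exact: pos_part_path_right_continuous. Qed.
Let rn w : right_continuous (n ^~ w). Proof. exact: neg_part_path_right_continuous. Qed.

Let mW s : 0 <= s -> measurable_fun setT (variation_process N s).
Proof. by apply: (adapted_measurable filtF); exact: variation_process_adapted. Qed.

Let mN s : 0 <= s -> measurable_fun setT (N s).
Proof. exact: (adapted_measurable filtF). Qed.

Let mp s : 0 <= s -> measurable_fun setT (p s).
Proof.
move=> s0; rewrite (_ : p s = fun w => (variation_process N s w + N s w) * 2^-1).
  by apply: measurable_funM => //; apply: measurable_funD; [exact: mW|exact: mN].
by apply/funext => w; rewrite /p pos_part_pathE.
Qed.

Let mn s : 0 <= s -> measurable_fun setT (n s).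
Proof.
move=> s0; rewrite (_ : n s = fun w => (variation_process N s w - N s w) * 2^-1).
  by apply: measurable_funM => //; apply: measurable_funB; [exact: mW|exact: mN].
by apply/funext => w; rewrite /n neg_part_pathE.
Qed.

Let itv w : set (measurableTypeR R) := `]0, rho_t w]%classic.

Let mitv w : measurable (itv w). Proof. exact: measurable_itv. Qed.

Let nu (f : R -> T -> R) w : {measure set (measurableTypeR R) -> \bar R} :=
  stieltjes_on (f ^~ w) (rho_t w).

Let nuE f w A : nu f w A = stieltjes_measure (f ^~ w) (A `&` itv w).
Proof. exact: stieltjes_onE. Qed.

Let trunc_min s w : 0 <= s ->
  trunc_time rho (Num.min s t) w = Num.min s (rho_t w).
Proof.
move=> s0; apply: EFin_inj.
rewrite EFin_min /rho_t !trunc_timeE; [|exact: st.1|exact: st.1].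
by rewrite EFin_min minA.
Qed.

(* On a predictable rectangle the random measure is an increment of f between
   stopped times. *)
Let rectangle (f : R -> T -> R) s u B w :
  nondecreasing (f ^~ w) -> right_continuous (f ^~ w) -> 0 <= s -> s <= u ->
  nu f w (path_section (`]s, u] `*` B) w) =
  (\1_B w * (f (trunc_time rho (Num.min u t) w) w - f (trunc_time rho (Num.min s t) w) w))%:E.
Proof.
move=> ndf rf s0 su; rewrite nuE !trunc_min ?(le_trans s0)// indicE.
have [Bw|Bw] := boolP (w \in B); last first.
  rewrite mul0r (_ : _ `&` _ = set0) ?measure0//; apply/seteqP; split => x; last by [].
  by move=> [[_ /= Bw'] _]; move/negP: Bw; apply; rewrite inE.
rewrite mul1r -(@stieltjes_measure_itv_oc _ (f ^~ w))//; last first.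
  by rewrite le_min ge_min su/= ge_min lexx orbT.
congr (stieltjes_measure _ _); apply/seteqP; split => x; rewrite /path_section /itv /= !in_itv/=.
  move=> [[/andP[sx xu] _] /andP[x0 xr]].
  by rewrite le_min xu xr gt_min sx.
rewrite le_min gt_min => /andP[+ /andP[xu xr]].
have -> : (rho_t w < x) = false by rewrite ltNge xr.
by rewrite orbF => sx; rewrite sx xu (le_lt_trans s0 sx); rewrite inE in Bw.
Qed.


Let D : set (R * T) := [set q | 0 <= q.1].

Let nuD f w : nu f w (path_section D w) = nu f w (path_section (`]0, t] `*` [set: T]) w).
Proof.
rewrite !nuE; congr (stieltjes_measure _ _); apply/seteqP; split => x;
  rewrite /path_section /itv /D /= !in_itv/= => -[_ /andP[x0 xr]]; rewrite x0 xr ?(ltW x0)//.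
split => //; split => //; apply: (le_trans xr).
by have /andP[] := trunc_time_itv (st.1 w) (ltW t0).
Qed.

Let m_at (f : R -> T -> R) s : (forall w, right_continuous (f ^~ w)) ->
  (forall s, 0 <= s -> measurable_fun setT (f s)) -> 0 <= s ->
  measurable_fun setT (fun w => f (trunc_time rho s w) w).
Proof.
move=> rf mf s0; have [s0'|s0'] := ltP 0 s.
  apply: (measurable_at_random_time s0' (fun w => trunc_time_itv (st.1 w) s0) (Y := f)) => //.
  exact: (measurable_trunc_time filtF st).
have -> : s = 0 by apply/eqP; rewrite eq_le s0 s0'.
rewrite (_ : (fun _ => _) = f 0); first exact: mf.
by apply/funext => w; rewrite trunc_time_id//; exact: st.1.
Qed.

Let trunc0 w : trunc_time rho 0 w = 0.
Proof. by rewrite trunc_time_id//; exact: st.1. Qed.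

Let incr_integrable (f : R -> T -> R) s : (forall w, nondecreasing (f ^~ w)) ->
  (forall w, right_continuous (f ^~ w)) ->
  (forall s, 0 <= s -> measurable_fun setT (f s)) ->
  (forall w s, 0 <= s -> f s w - f 0 w <= variation_process N s w) -> 0 <= s <= t ->
  P.-integrable setT (EFin \o (fun w => f (trunc_time rho s w) w - f 0 w)).
Proof.
move=> ndf rf mf fW /andP[s0 stt].
have iN0 : P.-integrable setT (EFin \o (fun w => N 0 w)).
  by have := iN (lexx 0); congr integrable; apply/funext => w /=; rewrite trunc0.
have iD : P.-integrable setT (EFin \o (fun w => k + `|N 0 w| + `|N (rho_t w) w|)).
  have i1 := integrableD measurableT (finite_measure_integrable_cst P k measurableT) (integrable_norm iN0).
  by have := integrableD measurableT i1 (integrable_norm (iN (ltW t0))).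
apply: (le_integrable measurableT _ _ iD).
  apply/measurable_EFinP; apply: measurable_funB; last exact: mf.
  exact: m_at.
move=> w _ /=; rewrite lee_fin.
have /andP[r0 rs] := trunc_time_itv (st.1 w) s0.
rewrite ger0_norm; last by rewrite subr_ge0; exact: ndf.
have srt : trunc_time rho s w <= rho_t w.
  by rewrite -lee_fin !trunc_timeE ?st.1// le_min !ge_min lee_fin stt lexx orbT.
apply: le_trans (ler_norm _); apply: le_trans (varN w).
apply: le_trans (fW _ _ (rho_t0 w)); rewrite lerD2r; exact: ndf.
Qed.

Let ip s : 0 <= s <= t -> P.-integrable setT (EFin \o (fun w => p (trunc_time rho s w) w - p 0 w)).
Proof. by apply: incr_integrable => // w u u0; exact: pos_part_path_incr. Qed.

Let inn s : 0 <= s <= t -> P.-integrable setT (EFin \o (fun w => n (trunc_time rho s w) w - n 0 w)).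
Proof. by apply: incr_integrable => // w u u0; exact: neg_part_path_incr. Qed.

Let integrableW (f : T -> R) B : measurable B -> P.-integrable setT (EFin \o f) ->
  P.-integrable B (EFin \o f).
Proof. by move=> mB /(integrableS measurableT mB (@subsetT _ _)). Qed.

(* The martingale property of N = p - n, written for p and n separately. *)
Let incr_eq s r B : 0 <= s -> s <= r -> r <= t -> F s B ->
  (\int[P]_(w in B) (p (trunc_time rho r w) w - p (trunc_time rho s w) w)%:E =
   \int[P]_(w in B) (n (trunc_time rho r w) w - n (trunc_time rho s w) w)%:E)%E.
Proof.
move=> s0 sr rt BF; have r0 := le_trans s0 sr.
have mB : measurable B by exact: (filtration_measurable filtF s0).
have r0t : 0 <= r <= t by rewrite r0.
have s0t : 0 <= s <= t by rewrite s0 (le_trans sr).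
have NE w r' : 0 <= r' -> N (trunc_time rho r' w) w =
    p (trunc_time rho r' w) w - n (trunc_time rho r' w) w.
  move=> r0'; have /andP[h _] := trunc_time_itv (st.1 w) r0'.
  by rewrite (jordan_path (fN w) h).
have idp : P.-integrable setT (EFin \o (fun w => p (trunc_time rho r w) w - p (trunc_time rho s w) w)).
  have := integrableB measurableT (ip r0t) (ip s0t); congr integrable.
  by apply/funext => w /=; rewrite -EFinB; congr EFin; ring.
have idn : P.-integrable setT (EFin \o (fun w => n (trunc_time rho r w) w - n (trunc_time rho s w) w)).
  have := integrableB measurableT (inn r0t) (inn s0t); congr integrable.
  by apply/funext => w /=; rewrite -EFinB; congr EFin; ring.
have idpB := integrableW mB idp; have idnB := integrableW mB idn.
rewrite -[LHS](fineK (integrable_fin_num mB idpB)) -[RHS](fineK (integrable_fin_num mB idnB)).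
congr EFin; apply/eqP; rewrite -subr_eq0 -(RintegralB mB idpB idnB).
rewrite [X in X == _](_ : _ =
    \int[P]_(w in B) (N (trunc_time rho r w) w - N (trunc_time rho s w) w)).
  by rewrite (RintegralB mB (integrableW mB (iN r0)) (integrableW mB (iN s0))) (NB s0 sr BF) subrr.
by apply: eq_Rintegral => w _; rewrite !NE//; ring.
Qed.

Let measurable_rectangle (f : R -> T -> R) s u B : (forall w, nondecreasing (f ^~ w)) ->
  (forall w, right_continuous (f ^~ w)) ->
  (forall s, 0 <= s -> measurable_fun setT (f s)) -> 0 <= s -> s <= u -> measurable B ->
  measurable_fun setT (fun w => nu f w (path_section (`]s, u] `*` B) w)).
Proof.
move=> ndf rf mf s0 su mB; have u0 := le_trans s0 su.
under eq_fun do rewrite rectangle//.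
apply/measurable_EFinP; apply: measurable_funM; first exact: measurable_indic.
by apply: measurable_funB; apply: m_at => //; rewrite le_min ?s0 ?u0 ltW.
Qed.

Let rectangle_agree s u B : 0 <= s -> s <= u -> F s B ->
  agree_in_mean P (nu p) (nu n) (`]s, u] `*` B).
Proof.
move=> s0 su BF; have u0 := le_trans s0 su.
have mB : measurable B by exact: (filtration_measurable filtF s0).
split.
- move=> w; have [Bw|Bw] := boolP (w \in B).
    rewrite (_ : path_section _ w = `]s, u]%classic); first exact: measurable_itv.
    by apply/seteqP; split => x; rewrite /path_section /=; [case|split => //; rewrite inE in Bw].
  rewrite (_ : path_section _ w = set0)//; apply/seteqP; split => x; last by [].
  by move=> [_ /= Bw']; move/negP: Bw; apply; rewrite inE.
- exact: measurable_rectangle.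
- exact: measurable_rectangle.
under eq_integral do rewrite (@rectangle p)//.
under [in RHS]eq_integral do rewrite (@rectangle n)//.
have [ts|st'] := leP t s.
  have tu := le_trans ts su.
  by rewrite (min_idPr tu); apply: eq_integral => w _; rewrite !subrr !mulr0.
have sut : s <= Num.min u t by rewrite le_min su ltW.
have utt : Num.min u t <= t by rewrite ge_min lexx orbT.
have E (f : R -> T -> R) : (\int[P]_w (\1_B w * (f (trunc_time rho (Num.min u t) w) w - f (trunc_time rho s w) w))%:E =
   \int[P]_(w in B) (f (trunc_time rho (Num.min u t) w) w - f (trunc_time rho s w) w)%:E)%E.
  rewrite [RHS]integral_mkcond; apply: eq_integral => w _.
  by rewrite patchE indicE; case: (_ \in _); rewrite ?mul1r ?mul0r.
by rewrite !E; exact: incr_eq.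
Qed.


Let nu_lty f w A : measurable A -> (nu f w A < +oo)%E.
Proof.
move=> mA; apply: le_lt_trans (stieltjes_measure_lty (f ^~ w) 0 (rho_t w)).
rewrite nuE; apply: le_measure; last exact: subIsetr.
  by apply: mem_set; exact: measurableI.
by apply: mem_set; exact: mitv.
Qed.

Let initial_agree B : F 0 B -> agree_in_mean P (nu p) (nu n) ([set 0] `*` B).
Proof.
move=> B0.
have sec0 f w : nu f w (path_section ([set 0] `*` B) w) = 0%E.
  have E0 : path_section ([set 0] `*` B) w `&` `]0, rho_t w] = set0.
    by rewrite -subset0 => x; rewrite /path_section /= in_itv/= => -[[-> _]]; rewrite ltxx.
  by rewrite nuE /itv E0; exact: measure0.
split.
+ move=> w; have [Bw|Bw] := boolP (w \in B).
    rewrite (_ : path_section _ w = [set 0]); first exact: measurable_set1.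
    by apply/seteqP; split => x; rewrite /path_section /=; [case|split => //; rewrite inE in Bw].
  rewrite (_ : path_section _ w = set0)//; rewrite -subset0 => x.
  by move=> [_ /= Bw']; move/negP: Bw; apply; rewrite inE.
+ by under eq_fun do rewrite sec0; exact: measurable_cst.
+ by under eq_fun do rewrite sec0; exact: measurable_cst.
+ by apply: eq_integral => w _; rewrite !sec0.
Qed.

Let agree_predictable : predictable_sigma_algebra F `<=` agree_in_mean P (nu p) (nu n).
Proof.
have [_ mpD mnD intD] := rectangle_agree (lexx 0) (ltW t0) (filtrationT filtF (lexx 0)).
have finD f w : (nu f w (path_section D w) < +oo)%E.
  apply: nu_lty; rewrite (_ : path_section D w = `[0, +oo[%classic).
    exact: measurable_itv.
  by apply/seteqP; split => x; rewrite /path_section /D /= in_itv/= andbT.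
apply: (predictable_agree_in_mean filtF (finD p) (finD n)).
- have pE w : nu p w (path_section D w) = (p (rho_t w) w - p 0 w)%:E.
    rewrite nuD (@rectangle p 0 t setT w (@ndp w) (@rp w) (lexx 0) (ltW t0)).
    by rewrite (min_idPl (lexx t)) (min_idPl (ltW t0)) trunc0 indicE in_setT mul1r.
  under eq_integral do rewrite pE.
  have : P.-integrable setT (EFin \o (fun w => p (rho_t w) w - p 0 w)).
    by apply: ip; rewrite lexx ltW.
  move=> /(integrable_fin_num measurableT); rewrite fin_numElt => /andP[_].
  by [].
- split => [w|||].
  + rewrite (_ : path_section D w = `[0, +oo[%classic); first exact: measurable_itv.
    by apply/seteqP; split => x; rewrite /path_section /D /= in_itv/= andbT.
  + by under eq_fun do rewrite nuD.
  + by under eq_fun do rewrite nuD.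
  + under eq_integral do rewrite nuD.
    by under [in RHS]eq_integral do rewrite nuD.
- move=> A [[B B0 ->]|[s [u [B [s0 su BF ->]]]]]; last exact: rectangle_agree.
  exact: initial_agree.
Qed.

Let nu_le_incr w A : measurable A -> (nu p w A <= (p (rho_t w) w - p 0 w)%:E)%E.
Proof.
move=> mA; rewrite -(stieltjes_measure_itv_oc (rho_t0 w) (@ndp w) (@rp w)) nuE.
apply: le_measure; last exact: subIsetr.
  by apply: mem_set; exact: measurableI.
by apply: mem_set; exact: mitv.
Qed.

Let integral_nu_lty (E : set (R * T)) : (forall w, measurable (path_section E w)) ->
  measurable_fun setT (fun w => nu p w (path_section E w)) ->
  (\int[P]_w nu p w (path_section E w) < +oo)%E.
Proof.
move=> mE mpE.
have ipt : P.-integrable setT (EFin \o (fun w => p (rho_t w) w - p 0 w)).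
  by apply: ip; rewrite lexx ltW.
apply: le_lt_trans (_ : (\int[P]_w (p (rho_t w) w - p 0 w)%:E < +oo)%E).
  apply: ge0_le_integral => //.
  - by have /integrableP[] := ipt.
  - by move=> w _; exact: nu_le_incr.
by move: (integrable_fin_num measurableT ipt); rewrite fin_numElt => /andP[_].
Qed.

Let nu_fin f w A : measurable A -> nu f w A \is a fin_num.
Proof. by move=> mA; rewrite ge0_fin_numE//; exact: nu_lty. Qed.

Let positive_part_le (E : set (R * T)) w : E = [set q | 0 <= q.1 /\ 0 < N q.1 q.2] ->
  measurable (path_section E w) -> N 0 w <= 0 ->
  ((Num.max 0 (N (rho_t w) w))%:E + nu n w (path_section E w) <=
    nu p w (path_section E w))%E.
Proof.
move=> EE mE N0.
rewrite -(fineK (nu_fin n w mE)) -(fineK (nu_fin p w mE)) -EFinD lee_fin -lerBrDr.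
have [r0|r0] := ltP 0 (rho_t w); last first.
  have rE : rho_t w = 0 by apply/eqP; rewrite eq_le r0 rho_t0.
  have nu0 f : nu f w (path_section E w) = 0%E.
    by rewrite nuE /itv rE set_itvoc0 setI0 measure0.
  by rewrite !nu0 subrr rE ge_max lexx N0.
have := @pos_part_le_stieltjes R (N ^~ w) (p ^~ w) (n ^~ w) (rho_t w) r0 (@ndp w) (@rp w) (@ndn w) (@rn w)
  (fun x x0 => jordan_path (fN w) x0) (cN w).1 N0.
rewrite !nuE (_ : path_section E w `&` itv w = [set s | 0 < N s w] `&` `]0, rho_t w])//.
rewrite EE; apply/seteqP; split => x; rewrite /path_section /itv /= !in_itv/=.
  by move=> [[_ Nx] xr].
by move=> [Nx /andP[x0 xr]]; rewrite x0 xr (ltW x0).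
Qed.

(** The two parts of dN, cut at rho, agree in mean on predictable rectangles by the
    martingale property, hence on the predictable set {N > 0}. So the integral of
    the indicator of {N > 0} against dN has mean 0 up to rho, whereas pathwise it
    dominates the positive part of N at rho. *)
Lemma stopped_predictable_martingale_le0 :
  predictable_sigma_algebra F [set q | 0 <= q.1 /\ 0 < N q.1 q.2] ->
  {ae P, forall w, N 0 w <= 0} ->
  {ae P, forall w, N (trunc_time rho t w) w <= 0}.
Proof.
move=> predE N0; have [mE mpE mnE intE] := agree_predictable predE.
have mNr : measurable_fun setT (fun w => N (rho_t w) w).
  by apply/measurable_EFinP; have /integrableP[] := iN (ltW t0).
have poo : (\int[P]_w nu p w (path_section [set q | 0%R <= q.1 /\ 0%R < N q.1 q.2]%R w) < +oo)%E.
  exact: integral_nu_lty mE mpE.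
apply: (ae_le0_of_integral_eq mNr mnE mpE _ _ (esym intE) poo).
- by move=> w; exact: measure_ge0.
- by move=> w; exact: measure_ge0.
- by apply: filterS N0 => w N0; exact: (positive_part_le erefl (mE w) N0).
Qed.

End stopped_predictable_martingale.

(** * Uniqueness of the decomposition *)

Section uniqueness.
Context {R : realType} {d : measure_display} {T : measurableType d}.
Variables (P : probability T R) (F : R -> set (set T)).
Hypothesis filtF : filtration F.
Implicit Types (X M A : R -> T -> R).

(** A' < A if and only if some rational lies strictly between them. *)
Lemma predictable_difference_pos A A' : predictable F A -> predictable F A' ->
  predictable_sigma_algebra F [set q | 0 <= q.1 /\ 0 < A q.1 q.2 - A' q.1 q.2].
Proof.
move=> pA pA'; pose r n : R := ratr (odflt 0%Q (unpickle n)).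
have -> : [set q | 0 <= q.1 /\ 0 < A q.1 q.2 - A' q.1 q.2] =
    \bigcup_n ([set q | 0 <= q.1 /\ `]r n, +oo[%classic (A q.1 q.2)] `&`
               [set q | 0 <= q.1 /\ `]-oo, r n[%classic (A' q.1 q.2)]).
  apply/seteqP; split => -[x w] /=.
    move=> [x0]; rewrite subr_gt0 => /rat_in_itvoo[q]; rewrite in_itv/= => /andP[qA' qA].
    have rq : r (pickle q) = ratr q by rewrite /r pickleK.
    exists (pickle q); first exact: Logic.I.
    by split; (split; first exact: x0); rewrite /= rq in_itv/= ?qA ?qA'.
  move=> [n _ [[x0 +] [_]]]; rewrite /= !in_itv/= andbT => rA A'r.
  by rewrite subr_gt0 (lt_trans A'r).
apply: sigma_algebra_bigcup => n.
have [_ _ _ +] := (sigma_algebraP (@predictable_sigma_algebra_sub _ _ _ F)).1 (smallest_sigma_algebra _ _).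
by apply; [apply: pA|apply: pA']; exact: measurable_itv.
Qed.

(** The difference N = A - A' is also M' - M, so N stopped at the localizing times
    is at most 0. For a given path and a given time some localizing time is later;
    grid points exhaust the times by right continuity, and there are countably many
    of them, so that one null set suffices. *)
Lemma decomposition_le M M' A A' :
  local_martingale P F M -> local_martingale P F M' -> cadlag M -> cadlag M' ->
  adapted F A -> adapted F A' -> cadlag A -> cadlag A' ->
  predictable F A -> predictable F A' -> finite_variation A -> finite_variation A' ->
  {ae P, forall w, A 0 w = 0} -> {ae P, forall w, A' 0 w = 0} ->
  {ae P, forall w, M 0 w = 0} -> {ae P, forall w, M' 0 w = 0} ->
  {ae P, forall w, forall t, 0 <= t -> M t w + A t w = M' t w + A' t w} ->
  {ae P, forall w, forall t, 0 <= t -> A t w <= A' t w}.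
Proof.
move=> [_ [tau [st taucv mM]]] [_ [tau' [st' tau'cv mM']]] cM cM' aA aA' cA cA' pA pA' fA fA'.
move=> A0 A'0 M0 M'0 MA.
pose N t w := A t w - A' t w.
have aN : adapted F N.
  move=> t t0 B mB.
  have mA := adapted_measurable_fun filtF aA t0.
  have mA' := adapted_measurable_fun filtF aA' t0.
  have := measurable_funB mA mA' measurableT mB.
  by rewrite setTI (filtration_measurableE filtF).
have cN : cadlag N by move=> w; exact: cadlag_pathB.
have fN : finite_variation N by move=> w; exact: finite_variation_pathB.
have NE : {ae P, forall w, forall t, 0 <= t -> N t w = (M' t w - M' 0 w) - (M t w - M 0 w)}.
  apply: filterS3 M0 M'0 MA => w /= -> -> MAw t t0.
  by rewrite !subr0 /N; apply/eqP; rewrite subr_eq -subr_eq0; move/eqP: (MAw t t0);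
     rewrite -subr_eq0; congr (_ == 0); ring.
have N0 : {ae P, forall w, N 0 w <= 0}.
  by apply: filterS2 A0 A'0 => w /= A0w A'0w; rewrite /N A0w A'0w subrr.
pose rho n w := Order.min (tau n w) (Order.min (tau' n w) (variation_hitting N n w)).
have key n i m : {ae P, forall w, N (trunc_time (rho n) (grid_point 1 m i.+1) w) w <= 0}.
  have g0 : 0 < grid_point 1 m i.+1 :> R by rewrite -(grid_point0 1 m); exact: grid_point_lt.
  have H := difference_localized filtF n cM cM' (st n) (st' n) (mM n) (mM' n) aN cN fN NE.
  have st_rho : stopping_time F (rho n) := localizing_stopping filtF n (st n) (st' n) aN cN fN.
  have varH w := localized_variation_le filtF n (st n) (st' n) aN cN fN w (ltW g0).
  have iH r (r0 : 0 <= r) := (H r r _ r0 (lexx r) (filtrationT filtF r0)).1.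
  have eH s r B (s0 : 0 <= s) (sr : s <= r) (BF : F s B) := (H s r B s0 sr BF).2.
  exact: (stopped_predictable_martingale_le0 filtF aN cN fN st_rho g0 iH eH varH
    (predictable_difference_pos pA pA') N0).
have {}key : {ae P, forall w, forall n i m, N (trunc_time (rho n) (grid_point 1 m i.+1) w) w <= 0}.
  by apply: ae_foralln => n; apply: ae_foralln => i; apply: ae_foralln => m; exact: key.
apply: filterS3 taucv tau'cv (filterI key N0) => w [_ tauw] [_ tau'w] [keyw N0w] t t0.
have Ng m i : N (grid_point 1 m i) w <= 0.
  case: i => [|i]; first by rewrite grid_point0.
  set s := grid_point 1 m i.+1; have s0 : 0 <= s by exact: grid_point_ge0.
  near \oo => n.
  rewrite -(@trunc_time_id _ _ _ (rho n) s w); first exact: keyw.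
  rewrite /rho !le_min; apply/and3P; split.
  - by near: n; move/cvgeyPge : tauw; apply.
  - by near: n; move/cvgeyPge : tau'w; apply.
  - rewrite ltW// ltNge variation_hitting_le// -ltNge.
    by near: n; exact: nbhs_infty_gtr.
rewrite -subr_le0; have cg := cvg_comp_grid_ceil (f := N ^~ w) (ltr01 : 0 < 1 :> R) t0 ((cN w).1 t t0).
apply: (ler_cvg_to cg (cvg_cst _)); apply: nearW => m; exact: Ng.
Unshelve. all: by end_near. Qed.

Lemma decomposition_unique X M A M' A' :
  semimartingale_decomposition P F X M A -> semimartingale_decomposition P F X M' A' ->
  indistinguishable P A A'.
Proof.
move=> [_ [mM cM M0] [aA cA pA fA A0] XE] [_ [mM' cM' M'0] [aA' cA' pA' fA' A'0] XE'].
have MA : {ae P, forall w, forall t, 0 <= t -> M t w + A t w = M' t w + A' t w}.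
  by apply: filterS2 XE XE' => w Xw Xw' t t0; rewrite -Xw// -Xw'.
have MA' : {ae P, forall w, forall t, 0 <= t -> M' t w + A' t w = M t w + A t w}.
  by apply: filterS MA => w MAw t t0; rewrite MAw.
have le := decomposition_le mM mM' cM cM' aA aA' cA cA' pA pA' fA fA' A0 A'0 M0 M'0 MA.
have ge := decomposition_le mM' mM cM' cM aA' aA cA' cA pA' pA fA' fA A'0 A0 M'0 M0 MA'.
apply: filterS2 le ge => w lew gew t t0.
by apply/eqP; rewrite eq_le lew// gew.
Qed.

End uniqueness.

(** * Jumps of paths and sums of integrators *)

Section jumps.
Context {R : realType}.
Implicit Types (x : R -> R) (s t : R) (q r : rat).

(* The times at which x jumps over the level q, having stayed below it since r.
   There is at most one: x exceeds q there, so a later such time would have to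
   stay below q at the earlier one. *)
Let upcross x q r : set R :=
  [set s | [/\ ratr r < s, forall u, ratr r < u < s -> x u < ratr q & ratr q < x s]].

Let upcross_subset1 x q r : is_subset1 (upcross x q r).
Proof.
move=> s s' [rs Hs qs] [rs' Hs' qs']; have [ss|ss|//] := ltgtP s s'.
- have := Hs' s; rewrite rs ss => /(_ isT).
  by rewrite ltNge (ltW qs).
- have := Hs s'; rewrite rs' ss => /(_ isT).
  by rewrite ltNge (ltW qs').
Qed.

Let countable_upcross x q r : countable (upcross x q r).
Proof.
have [->|/set0P[s Ss]] := eqVneq (upcross x q r) set0; first exact: countable0.
rewrite (_ : upcross x q r = [set s]); first exact: countable1.
by apply/seteqP; split => [s' Ss'|s' ->//]; exact: upcross_subset1 Ss' Ss.
Qed.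

Let upcross_cover x s l : x u @[u --> s^'-] --> l -> l < x s ->
  exists q r, upcross x q r s.
Proof.
move=> xl /rat_in_itvoo[q]; rewrite in_itv/= => /andP[lq qx].
have : \forall u \near s^'-, x u < ratr q by exact: (cvgr_lt l).
move=> [e /= e0 He]; have /rat_in_itvoo[r] : s - e < s by rewrite gtrBl.
rewrite in_itv/= => /andP[er rs]; exists q, r; split => // u /andP[ru us].
by apply: He => //=; rewrite ger0_norm ?subr_ge0 ?(ltW us)// ltrBlDl -ltrBlDr (lt_trans er).
Qed.

(** An upward jump crosses some rational level q, and the path is below q on some
    interval ]r, s[ to its left with r rational; a downward jump is an upward jump
    of the opposite path. *)
Lemma countable_jumps x : cadlag_path x ->
  countable [set s | 0 < s /\ left_limit_path x s != x s].
Proof.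
move=> [_ lx]; pose B y (qr : rat * rat) := upcross y qr.1 qr.2.
apply: (@sub_countable _ _ _ (\bigcup_qr (B x qr `|` B (\- x) qr))); last first.
  apply: bigcup_countable => [|qr _]; first exact: countableP.
  rewrite -bigcup2E; apply: bigcup_countable => [|i _]; first exact: countableP.
  by rewrite /bigcup2; case: ifPn => _; [|case: ifPn => _; [|exact: countable0]]; exact: countable_upcross.
apply: subset_card_le => s [s0]; rewrite /left_limit_path s0.
move: (lx _ s0) => /cvg_ex[l xl]; rewrite (cvg_lim _ xl)//.
rewrite neq_lt => /orP[lxs|lxs].
  by have [q [r ?]] := upcross_cover xl lxs; exists (q, r) => //; left.
have xl' : (\- x) u @[u --> s^'-] --> - l by exact: cvgN.
have lxs' : - l < (\- x) s by rewrite ltrN2.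
by have [q [r ?]] := upcross_cover xl' lxs'; exists (q, r) => //; right.
Qed.

Lemma countable_null (mu : {measure set (measurableTypeR R) -> \bar R}) (K : set R) :
  countable K -> (forall s, K s -> mu [set s] = 0)%E -> (mu K = 0)%E.
Proof.
move=> cK K0; apply: measure_negligible.
  by apply: countable_measurable => // s; exact: measurable_set1.
have /countable_injP[f finj] := cK.
rewrite (_ : K = \bigcup_n (K `&` f @^-1` [set n])); last first.
  by apply/seteqP; split => [s Ks|s [n _ []]//]; exists (f s).
apply: negligible_bigcup => n.
have [->|/set0P[s [Ks fs]]] := eqVneq (K `&` f @^-1` [set n]) set0; first exact: negligible_set0.
exists [set s]; split; [exact: measurable_set1|exact: K0|].
move=> s' [Ks' fs'] /=; apply: finj; rewrite ?inE//.
by rewrite fs'.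
Qed.

End jumps.

Section sum_of_stieltjes.
Context {R : realType}.
Implicit Types (f g a c v x h : R -> R) (s t : R) (B : set (measurableTypeR R)).

Lemma stieltjes_measureD f g B : nondecreasing f -> right_continuous f ->
  nondecreasing g -> right_continuous g -> measurable B ->
  stieltjes_measure (fun s => f s + g s) B = (stieltjes_measure f B + stieltjes_measure g B)%E.
Proof.
move=> ndf rf ndg rg mB; rewrite -measure_addE.
have ndfg : nondecreasing (fun s => f s + g s) by move=> s t st; apply: lerD; [exact: ndf|exact: ndg].
have rfg : right_continuous (fun s => f s + g s) by move=> s; apply: cvgD; [exact: rf|exact: rg].
have := fun st => stieltjes_measure_itv_oc st ndfg rfg.
rewrite /(stieltjes_measure (fun s => f s + g s)); case: pselect => [H|[]//] E.
apply: lebesgue_stieltjes_measure_unique => // X [[s t] _ <-] /=.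
have [st|ts] := leP s t; last by rewrite set_itv_ge ?measure0// bnd_simp -leNgt ltW.
rewrite [LHS]E// [RHS]measure_addE !stieltjes_measure_itv_oc// -EFinD; congr EFin; ring.
Qed.

Lemma stieltjes_set1_eq0 f s : nondecreasing f -> right_continuous f ->
  f u @[u --> s^'-] --> f s -> (stieltjes_measure f [set s] = 0)%E.
Proof.
move=> ndf rf lf; apply/eqP; rewrite eq_le measure_ge0 andbT.
have cF : (f s - f u)%:E @[u --> s^'-] --> 0%E.
  apply/cvg_EFin; first exact: nearW.
  by rewrite -(subrr (f s)); apply: cvgB => //; exact: cvg_cst.
rewrite -(cvg_lim _ cF)//; apply: lime_ge; first exact: cvgP cF.
near=> u.
have us : u < s by near: u; exact: nbhs_left_lt.
rewrite /= -(stieltjes_measure_itv_oc (ltW us) ndf rf).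
apply: le_measure; rewrite ?inE; [exact: measurable_set1|exact: measurable_itv|].
by move=> y ->; rewrite /= in_itv/= us lexx.
Unshelve. all: by end_near. Qed.


Lemma LS_integral_indic a G t : measurable (G `&` `]0, t] : set (measurableTypeR R)) ->
  LS_integral a \1_G t =
    fine (stieltjes_measure (pos_part_path a) (G `&` `]0, t])) -
    fine (stieltjes_measure (neg_part_path a) (G `&` `]0, t])).
Proof.
move=> mG.
have E f : (\int[stieltjes_measure f]_(s in `]0%R, t]) (\1_G s)%:E =
    stieltjes_measure f (G `&` `]0%R, t]))%E.
  have -> : G `&` `]0, t] = (G `&` `]0, t]) `&` `]0, t] by rewrite -setIA setIid.
  rewrite -integral_indic//; apply: eq_integral => s; rewrite inE => st.
  by rewrite !indicE in_setI [s \in `]0, t]%classic]mem_set// andbT.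
by rewrite /LS_integral /Rintegral !E.
Qed.

(** The Jordan decomposition is not additive, but p - n is: the identity
    p_a + n_c + n_v = n_a + p_c + p_v holds between nondecreasing functions, hence
    between their Stieltjes measures. *)
Lemma LS_integral_indicD a c v G t : measurable (G `&` `]0, t] : set (measurableTypeR R)) ->
  finite_variation_path a -> cadlag_path a ->
  finite_variation_path c -> cadlag_path c ->
  finite_variation_path v -> cadlag_path v ->
  (forall s, 0 <= s -> a s = c s + v s) ->
  LS_integral a \1_G t = LS_integral c \1_G t + LS_integral v \1_G t.
Proof.
move=> mG fa ca fc cc fv cv acv; rewrite !LS_integral_indic//.
set B := G `&` `]0, t].
have fin f : stieltjes_measure f B \is a fin_num.
  rewrite ge0_fin_numE//; apply: le_lt_trans (stieltjes_measure_lty f 0 t).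
  by apply: le_measure; [exact: mem_set|apply: mem_set; exact: measurable_itv|exact: subIsetr].
have ndp b : finite_variation_path b -> nondecreasing (pos_part_path b) by exact: pos_part_path_nondecreasing.
have ndn b : finite_variation_path b -> nondecreasing (neg_part_path b) by exact: neg_part_path_nondecreasing.
have rp b : finite_variation_path b -> cadlag_path b -> right_continuous (pos_part_path b) by exact: pos_part_path_right_continuous.
have rn b : finite_variation_path b -> cadlag_path b -> right_continuous (neg_part_path b) by exact: neg_part_path_right_continuous.
have partE b s : pos_part_path b s = pos_part_path b (Num.max 0 s) /\
    neg_part_path b s = neg_part_path b (Num.max 0 s).
  by rewrite /pos_part_path /neg_part_path maxA maxxx.
have sumE : (fun s => pos_part_path a s + (neg_part_path c s + neg_part_path v s)) =
    (fun s => neg_part_path a s + (pos_part_path c s + pos_part_path v s)).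
  apply/funext => s.
  rewrite (partE a s).1 (partE a s).2 (partE c s).1 (partE c s).2 (partE v s).1 (partE v s).2.
  have m0 : 0 <= Num.max 0 s by rewrite le_max lexx.
  have := acv _ m0; rewrite (jordan_path fa m0) (jordan_path fc m0) (jordan_path fv m0); lra.
have ndD f g : nondecreasing f -> nondecreasing g -> nondecreasing (fun s => f s + g s).
  by move=> ndf ndg x y xy; apply: lerD; [exact: ndf|exact: ndg].
have rD f g : right_continuous f -> right_continuous g -> right_continuous (fun s => f s + g s).
  by move=> rf rg x; apply: cvgD; [exact: rf|exact: rg].
have arith (x1 x2 x3 x4 x5 x6 : R) : x1 + (x2 + x3) = x4 + (x5 + x6) ->
  x1 - x4 = x5 - x2 + (x6 - x3) by lra.
have := congr1 (fun f => fine (stieltjes_measure f B)) sumE.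
rewrite !stieltjes_measureD; auto.
rewrite !fineD; try by rewrite ?fin_numD ?fin.
exact: arith.
Qed.

End sum_of_stieltjes.

(** * Continuous integrators do not see jumps *)

Section left_limits.
Context {R : realType}.
Implicit Types (v x : R -> R) (s t : R).

Lemma continuous_cadlag_path v : {within `[0, +oo[, continuous v} -> cadlag_path v.
Proof.
move=> /continuous_within_itvcyP[cv v0]; split => t t0.
  move: t0; rewrite le_eqVlt => /predU1P[<-//|t0].
  have /left_right_continuousP[]// : {for t, continuous v}.
  by apply: cv; rewrite in_itv/= t0.
have /left_right_continuousP[lv _] : {for t, continuous v}.
  by apply: cv; rewrite in_itv/= t0.
exact: cvgP lv.
Qed.

Lemma neg_part_path_left_continuous v s : finite_variation_path v -> 0 < s ->
  v u @[u --> s^'-] --> v s -> neg_part_path v u @[u --> s^'-] --> neg_part_path v s.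
Proof.
move=> fv s0 lv; rewrite neg_part_pathE//; last exact: ltW.
have tvs : fine (total_variation 0 u v) @[u --> s^'-] --> fine (total_variation 0 s v).
  by apply: (total_variation_left_continuous s0 (lexx s)) => //; exact/fv/ltW.
have : (fine (total_variation 0 u v) - v u) / 2 @[u --> s^'-] --> (fine (total_variation 0 s v) - v s) / 2.
  by apply: cvgMl; exact: cvgB.
apply: cvg_trans; apply: near_eq_cvg; near=> u; rewrite neg_part_pathE//.
by near: u; exact: nbhs_left_ge.
Unshelve. all: by end_near. Qed.

Lemma pos_part_path_left_continuous v s : finite_variation_path v -> 0 < s ->
  v u @[u --> s^'-] --> v s -> pos_part_path v u @[u --> s^'-] --> pos_part_path v s.
Proof.
move=> fv s0 lv; apply: (neg_part_path_left_continuous (v := \- v)) => //.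
  exact: finite_variation_pathN.
exact: cvgN.
Qed.

Lemma measurable_nonzero_times x t : cadlag_path x ->
  measurable ([set s | x s != 0] `&` `]0, t] : set (measurableTypeR R)).
Proof.
move=> [rx _].
have mx : measurable_fun (`]0, t]%classic : set (measurableTypeR R)) x.
  by apply: measurable_right_continuous => s /andP[s0 _]; exact: rx.
have := mx (measurable_itv _) _ (measurableC (measurable_set1 (0 : R))).
by rewrite setIC; congr measurable; congr (_ `&` _); apply/seteqP; split => s /= /eqP.
Qed.

(** The two integrands differ on the countable set of jump times of x, which is
    null for both parts of dv because dv has no atoms. *)
Lemma LS_integral_left_limit v x t : {within `[0, +oo[, continuous v} ->
  finite_variation_path v -> cadlag_path x ->
  LS_integral v \1_[set s | x s != 0] t =
  LS_integral v \1_[set s | left_limit_path x s != 0] t.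
Proof.
move=> cv fv cx; have dv := continuous_cadlag_path cv.
have lv s : 0 < s -> v u @[u --> s^'-] --> v s.
  move=> s0; have /continuous_within_itvcyP[cv' _] := cv.
  have /left_right_continuousP[]// : {for s, continuous v}.
  by apply: cv'; rewrite in_itv/= s0.
pose K := [set s | 0 < s /\ left_limit_path x s != x s].
have cK : countable K by exact: countable_jumps.
have mK (K' : set R) : K' `<=` K -> measurable (K' : set (measurableTypeR R)).
  move=> K'K; apply: countable_measurable => [s|]; first exact: measurable_set1.
  exact: sub_countable (subset_card_le K'K) cK.
pose A := [set s | x s != 0] `&` `]0, t].
pose B := [set s | left_limit_path x s != 0] `&` `]0, t].
have mA : measurable (A : set (measurableTypeR R)) by exact: measurable_nonzero_times.
have AB : A `\` K = B `\` K.
  apply/seteqP; split => s [[/= xs st]] nK; (split; last by []); (split; last by []);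
  move: st; rewrite /= in_itv/= => /andP[s0 _];
  have [xE|xE] := eqVneq (left_limit_path x s) (x s); rewrite ?xE// -?xE//;
  by exfalso; apply: nK.
have BE : B = (A `\` K) `|` (B `&` K) by rewrite AB setUC setUIDK.
have mB : measurable (B : set (measurableTypeR R)).
  rewrite BE; apply: measurableU; last by apply: mK; exact: subIsetr.
  by apply: measurableD => //; exact: mK.
have null f : nondecreasing f -> right_continuous f ->
    (forall s, 0 < s -> f u @[u --> s^'-] --> f s) ->
    stieltjes_measure f A = stieltjes_measure f B.
  move=> ndf rf lf.
  have K0 : (stieltjes_measure f K = 0)%E.
    by apply: countable_null => // s [s0 _]; apply: stieltjes_set1_eq0 => //; exact: lf.
  have H C : measurable (C : set (measurableTypeR R)) ->
      stieltjes_measure f (C `\` K) = stieltjes_measure f C.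
    move=> mC; rewrite -[in RHS](setUIDK C K) measureU.
    - have CK0 : (stieltjes_measure f (C `&` K) = 0)%E.
        apply/eqP; rewrite eq_le measure_ge0 andbT -K0; apply: le_measure; last exact: subIsetr.
          by apply: mem_set; apply: mK; exact: subIsetr.
        by apply: mem_set; exact: mK.
      exact: (esym (etrans (congr1 (fun z => z + stieltjes_measure f (C `\` K))%E CK0) (add0e _))).
    - by apply: measurableI => //; exact: mK.
    - by apply: measurableD => //; exact: mK.
    - by rewrite -subset0 => s [[_ ?] [_ ?]].
  by rewrite -(H A)// -(H B)// AB.
rewrite !LS_integral_indic//; congr (fine _ - fine _).
- apply: null.
  + exact: pos_part_path_nondecreasing.
  + exact: pos_part_path_right_continuous.
  + by move=> s s0; apply: pos_part_path_left_continuous => //; exact: lv.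
- apply: null.
  + exact: neg_part_path_nondecreasing.
  + exact: neg_part_path_right_continuous.
  + by move=> s s0; apply: neg_part_path_left_continuous => //; exact: lv.
Qed.

End left_limits.

(** * The equivalence *)

Theorem corollary1 (R : realType) (d : measure_display) (T : measurableType d)
    (P : probability T R) (F : R -> set (set T)) (X M A : R -> T -> R) :
  filtration F -> usual_conditions P F ->
  semimartingale_decomposition P F X M A ->
  (class_Sigma P F X <->
   exists V C : R -> T -> R,
    [/\ [/\ adapted F V, continuous_process V & finite_variation V],
        [/\ predictable F C, cadlag C & finite_variation C],
        indistinguishable P A (fun t w => C t w + V t w),
        carried_by_zeros P X C &
        carried_by_left_zeros P X V]).
Proof.
move=> filtF _ dec; have [[_ cX] _ [aA cA pA fA _] _] := dec; split.
  move=> [M' [A' [dec' zA']]].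
  (* A itself can serve as C: the decomposition given by class Sigma has the same
     finite variation part. *)
  exists (fun _ _ => 0), A; split.
  - split => [t t0 B mB|w|w t t0].
    + have [B0|B0] := pselect (B 0).
        rewrite (_ : _ @^-1` _ = setT); first exact: filtrationT.
        by apply/seteqP; split.
      rewrite (_ : _ @^-1` _ = set0); first exact: filtration0.
      by apply/seteqP; split.
    + by move=> s; exact: cvg_cst.
    + exact: nondecreasing_bounded_variation.
  - by split.
  - by apply: aeW => w t _; rewrite addr0.
  - apply: filterS2 (decomposition_unique filtF dec dec') zA' => w AA' zw t t0.
    by rewrite (eq_LS_integral (b := A' ^~ w)) ?zw// => s; exact: AA'.
  - apply: aeW => w t _; rewrite /LS_integral.
    rewrite -[pos_part_path _]/(neg_part_path (\- (fun=> 0))).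
    by rewrite (@eq_neg_part_path R (\- (fun=> 0)) (fun=> 0)) ?subrr// => s _ /=; rewrite oppr0.
move=> [V [C [[_ cV fV] [_ cC fC] ACV zC zV]]].
exists M, A; split; first exact: dec.
apply: filterS3 ACV zC zV => w ACVw zCw zVw t t0.
have mX := measurable_nonzero_times t (cX w).
rewrite (LS_integral_indicD mX (fA w) (cA w) (fC w) (cC w) (fV w) (continuous_cadlag_path (cV w)) ACVw).
by rewrite (LS_integral_left_limit t (cV w) (fV w) (cX w)) zCw// zVw// addr0.
Qed.
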